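(* There is an algorithm that, given a splitter network $G=(I\uplus S\uplus O,E)$ with capacities $c: I\uplus O\to[0,1]$, finds a steady-state $(t,F)$ for $(G,c)$ in time $O(|S|^2+|S|\,\mathrm{sd}(G_z))$, where $G_z$ is the graph obtained from $G$ by identifying all vertices of $I\cup O$ into a single vertex $z$, and $\mathrm{sd}(G_z)$ denotes the time needed to compute a stationary distribution (of the random walk) on any orientation of a subgraph of $G_z$.
   Context: A splitter network is a finite directed graph $G$ (loops and parallel arcs allowed) with arc set $E$ whose vertex set is partitioned as $I\uplus S\uplus O$, where each input $i\in I$ has out-degree $1$ and in-degree $0$, each output $o\in O$ has in-degree $1$ and out-degree $0$, and each splitter $s\in S$ has in-degree $2$ and out-degree $2$. For a vertex $v$, $\delta^+(v)$ and $\delta^-(v)$ denote its sets of outgoing and incoming arcs. A capacity function is a map $c:I\cup O\to[0,1]$. A steady-state for $(G,c)$ is a pair $(t,F)$ with $t:E\to[0,1]$ (throughput) and $F\subseteq E$ (fluid arcs; arcs of $E\setminus F$ are called saturated) such that: (R3) for each input $i$ with $\delta^+(i)=\{e\}$, $t(e)\le c(i)$, and if $e\in F$ then $t(e)=c(i)$; (R4) for each output $o$ with $\delta^-(o)=\{e\}$, $t(e)\le c(o)$, and if $e\notin F$ then $t(e)=c(o)$; (R5) for each splitter $s$, $\sum_{e\in\delta^-(s)}t(e)=\sum_{e\in\delta^+(s)}t(e)$; (R6) for each splitter $s$ with $\delta^-(s)=\{e_1,e_2\}$ and $e_1\notin F$, $t(e_1)\ge t(e_2)$; (R7) for each splitter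 $s$ with $\delta^+(s)=\{e_1,e_2\}$ and $e_1\in F$, $t(e_1)\ge t(e_2)$; (R8) for any arcs $uv\in E\setminus F$ and $vw\in F$, $t(uv)=1$ or $t(vw)=1$.
   Formalization: The time bound proved is O(|S|^2 + |S| sd(G_z) + d + 1), where d is the number of arcs going directly from an input to an output; the stated bound fails when S is empty, since the d throughputs of such arcs must still be written. *)

(* Defs.v *)
From mathcomp Require Import all_boot all_order all_algebra.
From mathcomp Require Import reals.
Set Implicit Arguments.
Unset Strict Implicit.
Unset Printing Implicit Defensive.
Import Order.TTheory GRing.Theory Num.Theory.
Local Open Scope ring_scope.

(** * Directed multigraphs and random walks *)

(* Arcs have an identity of their own, so loops and parallel arcs are allowed. *)
Record digraph (V : finType) := Digraph {
  arc : finType;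
  tail : arc -> V;
  head : arc -> V
}.

Section Digraph.
Variables (V : finType) (D : digraph V).

Definition outarcs (v : V) : {set arc D} := [set e | tail e == v].
Definition inarcs (v : V) : {set arc D} := [set e | head e == v].

(* The random walk leaves [u] by a uniformly chosen arc of [outarcs u]; it is
   defined when there is a vertex and every vertex has an outgoing arc. *)
Definition walkable : bool := (0 < #|V|)%N && [forall v, outarcs v != set0].

Definition walk_prob (R : realType) (u v : V) : R :=
  #|outarcs u :&: inarcs v|%:R / #|outarcs u|%:R.

Definition stationary (R : realType) (p : V -> R) : Prop :=
  [/\ forall v, 0 <= p v,
      \sum_v p v = 1
    & forall v, p v = \sum_u p u * walk_prob R u v].

End Digraph.

(* A digraph with vertices 0..n-1 and arcs 0..m-1, given by its list of
   (tail, head) pairs. *)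
Definition ord_digraph n m (a : {ffun 'I_m -> 'I_n * 'I_n}) : digraph 'I_n :=
  Digraph (fun k => (a k).1) (fun k => (a k).2).

(* Up to the names of vertices and arcs, [H] is obtained from [D] by deleting
   vertices and arcs and then reversing some of the remaining arcs. *)
Definition subgraph_orientation (V W : finType) (D : digraph V) (H : digraph W)
    : bool :=
  [exists f : {ffun W -> V}, exists g : {ffun arc H -> arc D},
    [&& injectiveb f, injectiveb g &
      [forall k : arc H,
         ((f (tail k), f (head k)) == (tail (g k), head (g k)))
      || ((f (tail k), f (head k)) == (head (g k), tail (g k)))]]].

(** * Splitter networks and steady states *)

Record splitter_network := SplitterNetwork {
  input : finType;
  splitter : finType;
  output : finType;
  graph :> digraph (input + splitter + output)%type;
  input_deg : forall i : input,
    #|outarcs graph (inl (inl i))| = 1%N /\ #|inarcs graph (inl (inl i))| = 0%N;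
  splitter_deg : forall s : splitter,
    #|outarcs graph (inl (inr s))| = 2%N /\ #|inarcs graph (inl (inr s))| = 2%N;
  output_deg : forall o : output,
    #|outarcs graph (inr o)| = 0%N /\ #|inarcs graph (inr o)| = 1%N
}.

Section Network.
Variable G : splitter_network.

Definition vertex : finType := (input G + splitter G + output G)%type.
Definition vin (i : input G) : vertex := inl (inl i).
Definition vspl (s : splitter G) : vertex := inl (inr s).
Definition vout (o : output G) : vertex := inr o.

(* [None] is the vertex z. *)
Definition merge_vertex (v : vertex) : option (splitter G) :=
  if v is inl (inr s) then Some s else None.

Definition merged : digraph (option (splitter G)) :=
  Digraph (fun e : arc G => merge_vertex (tail e))
          (fun e : arc G => merge_vertex (head e)).

(* Arcs from an input straight to an output meet no splitter, so their number is
   not bounded in terms of the number of splitters; all other arcs are at most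
   four times as many as the splitters. *)
Definition direct_arcs : {set arc G} :=
  [set e | (if tail e is inl (inl _) then true else false)
        && (if head e is inr _ then true else false)].

(* [F] is the set of fluid arcs; its complement is the set of saturated arcs. *)
Definition steady_state (R : realType) (c : input G + output G -> R)
    (t : arc G -> R) (F : {set arc G}) : Prop :=
  (forall e, 0 <= t e <= 1) /\
  (forall i e, outarcs G (vin i) = [set e] ->
     t e <= c (inl i) /\ (e \in F -> t e = c (inl i))) /\
  (forall o e, inarcs G (vout o) = [set e] ->
     t e <= c (inr o) /\ (e \notin F -> t e = c (inr o))) /\
  (forall s, \sum_(e in inarcs G (vspl s)) t e
           = \sum_(e in outarcs G (vspl s)) t e) /\
  (forall s e1 e2, inarcs G (vspl s) = [set e1; e2] ->
     e1 \notin F -> t e2 <= t e1) /\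
  (forall s e1 e2, outarcs G (vspl s) = [set e1; e2] ->
     e1 \in F -> t e2 <= t e1) /\
  (forall e f : arc G, head e = tail f ->
     e \notin F -> f \in F -> t e = 1 \/ t f = 1).

End Network.

(** * Model of computation *)

(* A solver is a black box computing stationary distributions, together with
   its running time on each encoded digraph. *)
Record solver (R : realType) := Solver {
  solve : forall n m, {ffun 'I_m -> 'I_n * 'I_n} -> 'I_n -> R;
  time : forall n m, {ffun 'I_m -> 'I_n * 'I_n} -> nat;
  solveP : forall n m (a : {ffun 'I_m -> 'I_n * 'I_n}),
    walkable (ord_digraph a) -> stationary (ord_digraph a) (solve a)
}.

(* Maximum running time of the solver over all encodings of those orientations
   of subgraphs of [D] on which the random walk is defined. *)
Definition sd (R : realType) (slv : solver R) (V : finType) (D : digraph V)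
    : nat :=
  \max_(n < #|V|.+1) \max_(m < #|arc D|.+1)
    \max_(a : {ffun 'I_m -> 'I_n * 'I_n}
          | walkable (ord_digraph a) && subgraph_orientation D (ord_digraph a))
      time slv a.

(* Programs for a unit-cost RAM with exact real arithmetic.  The memory consists
   of arrays of natural numbers and arrays of real numbers, named by natural
   numbers; a scalar variable is a cell of an array with a constant index.
   Natural numbers, used for addressing, are only added, subtracted (with
   truncation) and compared; there is no rounding of reals and no constant real
   other than 0 and 1, so programs do not depend on the real field. *)
Inductive nexp :=
  | NConst of nat
  | NGet of nat & nexp
  | NAdd of nexp & nexp
  | NSub of nexp & nexp.

Inductive rexp :=
  | RZero
  | ROne
  | RGet of nat & nexp
  | RAdd of rexp & rexp
  | RSub of rexp & rexp
  | RMul of rexp & rexp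
  | RDiv of rexp & rexp.

Inductive bexp :=
  | NLe of nexp & nexp
  | RLe of rexp & rexp
  | BNot of bexp
  | BAnd of bexp & bexp.

Inductive cmd :=
  | Skip
  | NSet of nat & nexp & nexp          (* array, index, value *)
  | RSet of nat & nexp & rexp          (* array, index, value *)
  | Seq of cmd & cmd
  | If of bexp & cmd & cmd
  | While of bexp & cmd
  | Stationary of nexp & nexp & nat & nat & nat.
      (* number of vertices, number of arcs, array of tails, array of heads,
         real array receiving the result *)

Record state (R : realType) := State {
  nmem : nat -> nat -> nat;
  rmem : nat -> nat -> R
}.

Definition upd (T : Type) (mem : nat -> nat -> T) (a i : nat) (x : T) :=
  fun b j => if (b == a) && (j == i) then x else mem b j.

Section Semantics.
Variable R : realType.
Implicit Type st : state R.

Fixpoint neval st (e : nexp) : nat :=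
  match e with
  | NConst k => k
  | NGet a i => nmem st a (neval st i)
  | NAdd e1 e2 => (neval st e1 + neval st e2)%N
  | NSub e1 e2 => (neval st e1 - neval st e2)%N
  end.

(* Division is that of the field: it returns 0 if the divisor is 0. *)
Fixpoint reval st (e : rexp) : R :=
  match e with
  | RZero => 0
  | ROne => 1
  | RGet a i => rmem st a (neval st i)
  | RAdd e1 e2 => reval st e1 + reval st e2
  | RSub e1 e2 => reval st e1 - reval st e2
  | RMul e1 e2 => reval st e1 * reval st e2
  | RDiv e1 e2 => reval st e1 / reval st e2
  end.

Fixpoint beval st (b : bexp) : bool :=
  match b with
  | NLe e1 e2 => (neval st e1 <= neval st e2)%N
  | RLe e1 e2 => reval st e1 <= reval st e2
  | BNot b1 => ~~ beval st b1
  | BAnd b1 b2 => beval st b1 && beval st b2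
  end.

Definition store st (r n : nat) (p : 'I_n -> R) : state R :=
  State (nmem st)
    (fun b j => if b == r then (if insub j is Some v then p v else rmem st b j)
                else rmem st b j).

(* [exec slv c st st' k]: run from [st], the command [c] halts in [st'] after
   time [k].  Every elementary command and every test costs 1 (the expressions
   of a given program have bounded size), and a call to the solver moreover
   costs the running time of the solver.  A call whose arrays do not encode a
   digraph gets stuck. *)
Inductive exec (slv : solver R) : cmd -> state R -> state R -> nat -> Prop :=
  | ExecSkip st : exec slv Skip st st 1
  | ExecNSet st a i e :
      exec slv (NSet a i e) st
        (State (upd (nmem st) a (neval st i) (neval st e)) (rmem st)) 1
  | ExecRSet st a i e :
      exec slv (RSet a i e) st
        (State (nmem st) (upd (rmem st) a (neval st i) (reval st e))) 1
  | ExecSeq c1 c2 st1 st2 st3 k1 k2 :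
      exec slv c1 st1 st2 k1 -> exec slv c2 st2 st3 k2 ->
      exec slv (Seq c1 c2) st1 st3 (k1 + k2)
  | ExecIf b c1 c2 st st' k :
      exec slv (if beval st b then c1 else c2) st st' k ->
      exec slv (If b c1 c2) st st' k.+1
  | ExecWhileEnd b c st :
      ~~ beval st b -> exec slv (While b c) st st 1
  | ExecWhile b c st1 st2 st3 k1 k2 :
      beval st1 b -> exec slv c st1 st2 k1 ->
      exec slv (While b c) st2 st3 k2 ->
      exec slv (While b c) st1 st3 (k1 + k2).+1
  | ExecStationary st en em at_ ah r n m (a : {ffun 'I_m -> 'I_n * 'I_n}) :
      neval st en = n -> neval st em = m ->
      (forall k : 'I_m, nmem st at_ k = (a k).1 /\ nmem st ah k = (a k).2) ->
      exec slv (Stationary en em at_ ah r) st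
        (store st r (solve slv a)) (time slv a).+1.

End Semantics.

(** * Input and output of programs *)

Section Encoding.
Variables (R : realType) (G : splitter_network).

(* Vertices are numbered from 0: inputs first, then splitters, then outputs. *)
Definition vertex_code (v : vertex G) : nat :=
  match v with
  | inl (inl i) => enum_rank i
  | inl (inr s) => (#|input G| + enum_rank s)%N
  | inr o => (#|input G| + #|splitter G| + enum_rank o)%N
  end.

Definition terminal_code (x : input G + output G) : nat :=
  match x with
  | inl i => vertex_code (vin i)
  | inr o => vertex_code (vout o)
  end.

Definition arc_code (e : arc G) : nat := enum_rank e.

Definition arc_array (f : arc G -> nat) (k : nat) : nat :=
  if [pick e | arc_code e == k] is Some e then f e else 0%N.

(* Natural arrays: 0 holds |I|, |S|, |O|, |E|; 1 and 2 hold the codes of the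
   tail and of the head of each arc.  Real array 0 holds the capacity of each
   terminal.  All other cells are 0. *)
Definition init_state (c : input G + output G -> R) : state R :=
  State
    (fun a k =>
       match a with
       | 0 => nth 0%N [:: #|input G|; #|splitter G|; #|output G|; #|arc G|] k
       | 1 => arc_array (fun e => vertex_code (tail e)) k
       | 2 => arc_array (fun e => vertex_code (head e)) k
       | _ => 0%N
       end)
    (fun a k =>
       match a with
       | 0 => if [pick x | terminal_code x == k] is Some x then c x else 0
       | _ => 0
       end).

(* The throughput is read in real array 1; an arc is fluid when its cell of
   natural array 3 is nonzero. *)
Definition out_throughput (st : state R) (e : arc G) : R :=
  rmem st 1 (arc_code e).

Definition out_fluid (st : state R) : {set arc G} :=
  [set e | nmem st 3 (arc_code e) != 0%N].

End Encoding.

(* Main.v *)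
Require Import Defs.
From mathcomp Require Import all_boot all_order all_algebra.
From mathcomp Require Import reals.
From mathcomp Require Import boolp.
From mathcomp Require Import lra zify.
(* MathComp's [path.arc] and [seq.head] would hide those of [Defs]. *)
Import Defs.
Set Implicit Arguments.
Unset Strict Implicit.
Unset Printing Implicit Defensive.
Import Order.TTheory GRing.Theory Num.Theory.

(* Start from the empty flow with all arcs fluid, keep the conditions at
   splitters and outputs true, and push flow from the inputs until each fluid
   input arc carries its capacity.  An excess arriving at a splitter leaves
   equally through the fluid arcs out of it that are not full; once there are
   none, the fuller of the two arcs into it becomes saturated and the excess
   leaves by decreasing the saturated arcs into it.  Splitting the excess thus is
   a random walk on an orientation of a subgraph of G_z (fluid arcs forwards,
   saturated arcs backwards), so that a stationary distribution p gives the
   direction p(source) / degree, along which one moves until an arc becomes full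
   or empty or the arcs into a splitter become equal.  The flow of a fluid arc only
   increases and that of a saturated arc only decreases, and saturated arcs stay
   saturated, so each arc sees boundedly many events and O(|S|) rounds suffice. *)

(** * The algorithm on flows *)

Section Balance.
Local Open Scope ring_scope.
Variables (R : realType) (G : splitter_network) (c : input G + output G -> R).
Hypothesis c01 : forall x, 0 <= c x <= 1.
Implicit Types (t w : arc G -> R) (F : {set arc G}) (e f : arc G).

Definition is_input (v : vertex G) := if v is inl (inl _) then true else false.
Definition is_output (v : vertex G) := if v is inr _ then true else false.
Definition is_splitter (v : vertex G) := if v is inl (inr _) then true else false.

Definition cap_in (v : vertex G) : R := if v is inl (inl i) then c (inl i) else 1.
Definition cap_out (v : vertex G) : R := if v is inr o then c (inr o) else 1.
Definition cap e : R := Num.min (cap_in (tail e)) (cap_out (head e)).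

Lemma cap_in01 v : 0 <= cap_in v <= 1.
Proof. by case: v => [[i|s]|o] /=; rewrite ?c01 // ler01 lexx. Qed.

Lemma cap_out01 v : 0 <= cap_out v <= 1.
Proof. by case: v => [[i|s]|o] /=; rewrite ?c01 // ler01 lexx. Qed.

Lemma cap_ge0 e : 0 <= cap e.
Proof.
have /andP[? _] := cap_in01 (tail e); have /andP[? _] := cap_out01 (head e).
by rewrite /cap le_min; apply/andP.
Qed.

Lemma cap_le1 e : cap e <= 1.
Proof. by rewrite /cap ge_min; case/andP: (cap_in01 (tail e)) => _ ->. Qed.

Lemma cap_spl e : ~~ is_input (tail e) -> ~~ is_output (head e) -> cap e = 1.
Proof.
by rewrite /cap; case: (tail e) => [[i|s]|o] //=; case: (head e) => [[i'|s']|o'] //= *;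
  rewrite minxx.
Qed.

Lemma tail_not_output e o : tail e = vout o -> False.
Proof.
have [+ _] := output_deg o => /eqP; rewrite cards_eq0 => /eqP h te.
by have : e \in set0; [rewrite -h inE te | rewrite inE].
Qed.

Lemma head_not_input e i : head e = vin i -> False.
Proof.
have [_ +] := input_deg i => /eqP; rewrite cards_eq0 => /eqP h te.
by have : e \in set0; [rewrite -h inE te | rewrite inE].
Qed.

Lemma input_tail_inj e f : is_input (tail e) -> tail e = tail f -> e = f.
Proof.
case te: (tail e) => [[i|]|] // _ tf.
have [/eqP/cards1P[x h] _] := input_deg i.
have : e \in [set x] by rewrite -h inE te.
have : f \in [set x] by rewrite -h inE -tf.
by rewrite !inE => /eqP-> /eqP->.
Qed.

Lemma output_head_inj e f : is_output (head e) -> head e = head f -> e = f.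
Proof.
case te: (head e) => [[|]|o] // _ tf.
have [_ /eqP/cards1P[x h]] := output_deg o.
have : e \in [set x] by rewrite -h inE te.
have : f \in [set x] by rewrite -h inE -tf.
by rewrite !inE => /eqP-> /eqP->.
Qed.

Lemma splitter_head_ex (s : splitter G) : exists e, head e = vspl s.
Proof.
have [_ h] := splitter_deg s.
have : (0 < #|inarcs G (vspl s)|)%N by rewrite /vspl h.
by rewrite card_gt0 => /set0Pn[e]; rewrite inE => /eqP ?; exists e.
Qed.

Lemma head_splitter e : ~~ is_output (head e) -> exists s, head e = vspl s.
Proof.
case h: (head e) => [[i|s]|o] //= _; first by case: (head_not_input h).
by exists s.
Qed.

Lemma tail_splitter e : ~~ is_input (tail e) -> exists s, tail e = vspl s.
Proof.
case h: (tail e) => [[i|s]|o] //= _; last by case: (tail_not_output h).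
by exists s.
Qed.

Lemma merge_Some (v : vertex G) s : merge_vertex v = Some s <-> v = vspl s.
Proof. by case: v => [[i|s']|o] //=; split => // -[->]. Qed.

(* [inv_pass] is stronger than (R8): an arc into a splitter is saturated only after
   all fluid arcs out of it have become full, which is never undone. *)
Record invariant t F : Prop := Invariant {
  inv_cap : forall e, 0 <= t e <= cap e;
  inv_out : forall e, is_output (head e) -> e \notin F -> t e = cap_out (head e);
  inv_direct : forall e, is_input (tail e) -> is_output (head e) -> e \in F ->
    t e = cap_in (tail e);
  inv_conserve : forall s : splitter G,
    \sum_(e in inarcs G (vspl s)) t e = \sum_(e in outarcs G (vspl s)) t e;
  inv_in : forall e f, head e = head f -> e \notin F -> t f <= t e;
  inv_tail : forall e f, tail e = tail f -> e \in F -> t f <= t e;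
  inv_pass : forall e f, head e = tail f -> e \notin F -> f \in F -> t f = 1
}.

Definition normalized t F : Prop :=
  (forall e, e \in F -> is_output (head e) -> ~~ is_input (tail e) -> t e < cap e) /\
  (forall e s, e \in F -> head e = vspl s ->
     (forall f, tail f = vspl s -> f \in F -> 1 <= t f) ->
     exists2 f, head f = vspl s & t e < t f).

Lemma invariant_steady t F : invariant t F ->
  (forall e, is_input (tail e) -> e \in F -> ~~ is_output (head e) -> cap e <= t e) ->
  steady_state c t F.
Proof.
move=> I noopen; split.
  move=> e; have /andP[-> h] := inv_cap I e.
  exact: le_trans h (cap_le1 e).
split.
  move=> i e /setP/(_ e); rewrite !inE eqxx => /eqP te.
  have /andP[h0 h1] := inv_cap I e.
  split; first by move: h1; rewrite /cap te /= le_min => /andP[].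
  move=> eF; apply/eqP; rewrite eq_le; apply/andP; split.
    by move: h1; rewrite /cap te /= le_min => /andP[].
  have [ho|ho] := boolP (is_output (head e)).
    by rewrite (inv_direct I _ ho eF) te.
  have := noopen e; rewrite te => /(_ isT eF ho); apply: le_trans.
  have [s hs] := head_splitter ho.
  by rewrite /cap te hs /= le_min lexx; case/andP: (c01 (inl i)).
split.
  move=> o e /setP/(_ e); rewrite !inE eqxx => /eqP te.
  have /andP[h0 h1] := inv_cap I e.
  split; first by move: h1; rewrite /cap te /= le_min => /andP[].
  by move=> /(inv_out I); rewrite te => ->.
split; first exact: inv_conserve I.
split.
  move=> s e1 e2 h; apply: (inv_in I).
  move/setP: h => h; move: (h e1) (h e2); rewrite !inE !eqxx orbT /=.
  by move=> /eqP-> /eqP->.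
split.
  move=> s e1 e2 h; apply: (inv_tail I).
  move/setP: h => h; move: (h e1) (h e2); rewrite !inE !eqxx orbT /=.
  by move=> /eqP-> /eqP->.
by move=> e f h eF fF; right; apply: (inv_pass I h).
Qed.

Lemma invariant_saturate_output t F e : invariant t F -> e \in F ->
  is_output (head e) -> cap e <= t e -> ~~ is_input (tail e) -> invariant t (F :\ e).
Proof.
move=> I eF ho ce ti; split; try by case: I.
- move=> f hf; rewrite !inE negb_and negbK => /orP[/eqP->|]; last exact: (inv_out I).
  apply/eqP; rewrite eq_le; have /andP[_ h] := inv_cap I e.
  have hc : cap e = cap_out (head e).
    rewrite /cap; case/andP: (cap_out01 (head e)) => _.
    by case: (tail_splitter ti) => s -> /= /min_idPr.
  by rewrite -hc h ce.
- by move=> f fi fo; rewrite !inE => /andP[_]; apply: (inv_direct I).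
- move=> f g hfg; rewrite !inE negb_and negbK => /orP[/eqP fe|]; last exact: (inv_in I).
  by rewrite fe in hfg *; rewrite (output_head_inj ho hfg).
- by move=> f g h; rewrite !inE => /andP[_]; apply: (inv_tail I).
- move=> f g h; rewrite !inE negb_and negbK => /orP[/eqP fe|fF] /andP[_ gF].
    by move: ho; rewrite -fe h; case tg: (tail g) => [[i|s]|o] //; case: (tail_not_output tg).
  exact: (inv_pass I h).
Qed.

Lemma invariant_saturate_in t F e s : invariant t F -> e \in F -> head e = vspl s ->
  (forall f, tail f = vspl s -> f \in F -> 1 <= t f) ->
  (forall f, head f = vspl s -> t f <= t e) -> invariant t (F :\ e).
Proof.
move=> I eF he hout hin; split; try by case: I.
- move=> f hf; rewrite !inE negb_and negbK => /orP[/eqP fe|]; last exact: (inv_out I).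
  by move: hf; rewrite fe he.
- by move=> f fi fo; rewrite !inE => /andP[_]; apply: (inv_direct I).
- move=> f g hfg; rewrite !inE negb_and negbK => /orP[/eqP fe|]; last exact: (inv_in I).
  by rewrite fe in hfg *; apply: hin; rewrite -hfg.
- by move=> f g h; rewrite !inE => /andP[_]; apply: (inv_tail I).
- move=> f g h; rewrite !inE negb_and negbK => /orP[/eqP fe|fF] /andP[_ gF].
    apply/eqP; rewrite eq_le hout // ?andbT; last by rewrite -h fe.
    by case/andP: (inv_cap I g) => _ /le_trans; apply; apply: cap_le1.
  exact: (inv_pass I h).
Qed.

(* The arcs that carry a move of the walk: forwards if fluid, backwards if
   saturated. *)
Definition usable t F e : bool :=
  if e \in F then t e < cap e else (0 < t e) && is_splitter (head e).
Definition src F e := merge_vertex (if e \in F then tail e else head e).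
Definition dst F e := merge_vertex (if e \in F then head e else tail e).

(* 0: fluid with room, 1: fluid and full, 2: saturated, 3: saturated and empty. *)
Definition rank t F e : nat :=
  if e \in F then nat_of_bool (cap e <= t e) else ((t e <= 0)%R + 2)%N.

Definition moved t F w (k : R) e : R :=
  t e + (if e \in F then w e else - w e) / k.

Section Step.
Variables (t : arc G -> R) (F : {set arc G}).
Hypotheses (I : invariant t F) (N : normalized t F).

(* [w e] is the speed at which the flow grows on a fluid arc [e] and shrinks on a
   saturated one. *)
Record direction w : Prop := Direction {
  dir_ge0 : forall e, 0 <= w e;
  dir_usable : forall e, ~~ usable t F e -> w e = 0;
  dir_conserve : forall s, \sum_(e | dst F e == Some s) w e = \sum_(e | src F e == Some s) w e;
  dir_src : forall e f, usable t F e -> usable t F f -> src F e = src F f -> w e = w f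
}.

Record step_bound w k : Prop := StepBound {
  bnd_gt0 : 0 < k;
  bnd_fluid : forall e, e \in F -> usable t F e -> w e <= k * (cap e - t e);
  bnd_sat : forall e, e \notin F -> usable t F e -> w e <= k * t e;
  bnd_pair : forall e f, head e = head f -> e \notin F -> f \in F ->
    w f + w e <= k * (t e - t f)
}.

Definition step_tight w k : Prop :=
  [\/ exists e, [/\ e \in F, usable t F e & w e = k * (cap e - t e)],
      exists e, [/\ e \notin F, usable t F e & w e = k * t e]
    | exists e f, [/\ head e = head f, e \notin F, f \in F &
                      w f + w e = k * (t e - t f)]].

Variables (w : arc G -> R) (k : R).
Hypotheses (D : direction w) (B : step_bound w k).
Let t' := moved t F w k.

Let k0 : 0 < k. Proof. exact: bnd_gt0 B. Qed.

Let moved_fluid e : e \in F -> t' e = t e + w e / k.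
Proof. by rewrite /t' /moved => ->. Qed.
Let moved_sat e : e \notin F -> t' e = t e - w e / k.
Proof. by rewrite /t' /moved => /negPf->; rewrite mulNr. Qed.
Let wk_ge0 e : 0 <= w e / k.
Proof. by rewrite divr_ge0 ?(ltW k0) // (dir_ge0 D). Qed.
Let moved_unusable e : ~~ usable t F e -> t' e = t e.
Proof. by rewrite /t' /moved => /(dir_usable D)->; rewrite oppr0 if_same mul0r addr0. Qed.

Let usable_tail e f : tail e = tail f -> e \in F -> f \in F ->
  usable t F e -> usable t F f.
Proof.
move=> ef eF fF; rewrite /usable eF fF.
have [ie|ie] := boolP (is_input (tail e)); first by rewrite (input_tail_inj ie ef).
have tef : t e = t f by apply/eqP; rewrite eq_le !(inv_tail I).
have [fo _|fo h] := boolP (is_output (head f)).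
  by apply: (proj1 N) => //; rewrite -ef.
rewrite (cap_spl _ fo) -?ef // -tef; exact: lt_le_trans h (cap_le1 e).
Qed.

Let usable_head e f : head e = head f -> e \notin F -> f \notin F ->
  usable t F e = usable t F f.
Proof.
move=> ef eF fF; rewrite /usable (negPf eF) (negPf fF) ef.
by have -> : t e = t f by apply/eqP; rewrite eq_le !(inv_in I).
Qed.

Lemma invariant_moved : invariant t' F.
Proof.
have cap_t' e : 0 <= t' e <= cap e.
  have /andP[h0 h1] := inv_cap I e.
  have [u|/moved_unusable->] := boolP (usable t F e); last by rewrite h0.
  have [eF|eF] := boolP (e \in F).
    rewrite moved_fluid // addr_ge0 //= -lerBrDl ler_pdivrMr // mulrC.
    exact: bnd_fluid B _ eF u.
  rewrite moved_sat // subr_ge0 ler_pdivrMr // mulrC (bnd_sat B) //=.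
  by apply: le_trans h1; rewrite gerBl.
split=> //.
- move=> e ho eF; rewrite -(inv_out I) // moved_unusable //.
  by rewrite /usable (negPf eF); case: (head e) ho => [[i|s]|o] // _; rewrite andbF.
- move=> e ti ho eF; rewrite -(inv_direct I) // moved_unusable //.
  by rewrite /usable eF -leNgt (inv_direct I) // ge_min lexx.
- move=> s; rewrite /t' /moved !big_split /= (inv_conserve I); congr (_ + _).
  rewrite -!mulr_suml; congr (_ / _).
  have dE e : (dst F e == Some s) = (if e \in F then head e == vspl s else tail e == vspl s).
    by rewrite /dst; case: ifP => _; apply/eqP/eqP => /merge_Some.
  have sE e : (src F e == Some s) = (if e \in F then tail e == vspl s else head e == vspl s).
    by rewrite /src; case: ifP => _; apply/eqP/eqP => /merge_Some.
  have E : \sum_(e in inarcs G (vspl s)) (if e \in F then w e else - w e)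
      - \sum_(e in outarcs G (vspl s)) (if e \in F then w e else - w e)
      = \sum_(e | dst F e == Some s) w e - \sum_(e | src F e == Some s) w e.
    rewrite [X in X - _ = _]big_mkcond [X in _ - X = _]big_mkcond.
    rewrite [X in _ = X - _]big_mkcond [X in _ = _ - X]big_mkcond -!sumrB.
    apply: eq_bigr => e _; rewrite !inE dE sE.
    by case: (e \in F); do 2!case: (_ == _); rewrite ?subr0 ?sub0r ?subrr ?opprK ?addNr.
  by rewrite (dir_conserve D s) subrr in E; move/eqP: E; rewrite subr_eq0 => /eqP.
- move=> e f ef eF; rewrite (moved_sat eF).
  have [fF|fF] := boolP (f \in F).
    have : (w f + w e) / k <= t e - t f by rewrite ler_pdivrMr // mulrC (bnd_pair B).
    by rewrite moved_fluid // mulrDl => h; lra.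
  rewrite moved_sat //.
  have -> : t f = t e by apply/eqP; rewrite eq_le !(inv_in I).
  suff -> : w f = w e by [].
  have [u|u] := boolP (usable t F e).
    apply: (dir_src D) => //; first by rewrite -(usable_head ef).
    by rewrite /src (negPf eF) (negPf fF) ef.
  by rewrite !(dir_usable D) // -(usable_head ef).
- move=> e f ef eF; rewrite (moved_fluid eF).
  have [fF|fF] := boolP (f \in F); last first.
    rewrite moved_sat // (le_trans (y := t f)) ?gerBl //.
    by rewrite (le_trans (inv_tail I ef eF)) // lerDl.
  have -> : t e = t f by apply/eqP; rewrite eq_le !(inv_tail I).
  rewrite moved_fluid //; suff -> : w f = w e by [].
  have [u|u] := boolP (usable t F e).
    apply: (dir_src D) => //; first exact: usable_tail ef _ _ u.
    by rewrite /src eF fF ef.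
  rewrite !(dir_usable D) //; apply: contra u; exact: usable_tail.
- move=> e f ef eF fF; rewrite moved_unusable ?(inv_pass I ef) //.
  by rewrite /usable fF (inv_pass I ef) // -leNgt cap_le1.
Qed.

Lemma rank_moved e : (rank t F e <= rank t' F e)%N.
Proof.
rewrite /rank; have [eF|eF] := boolP (e \in F).
  rewrite moved_fluid //; case h: (cap e <= t e) => //.
  by rewrite (le_trans h) // lerDl.
rewrite leq_add2r moved_sat //; case h: (t e <= 0) => //.
by rewrite (le_trans _ h) // gerBl.
Qed.

Lemma moved_tight : step_tight w k ->
  (exists2 e, (rank t F e < rank t' F e)%N & usable t F e) \/ ~ normalized t' F.
Proof.
case=> [[e [eF u E]]|[e [eF u E]]|[e [f [ef eF fF E]]]].
- left; exists e => //; rewrite /rank eF moved_fluid // E mulrC mulKf ?gt_eqF //.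
  by move: u; rewrite /usable eF addrC subrK lexx ltNge => /negPf->.
- left; exists e => //; rewrite /rank (negPf eF) moved_sat // E mulrC mulKf ?gt_eqF //.
  by move: u; rewrite /usable (negPf eF) subrr lexx ltNge => /andP[/negPf->].
right=> -[_ N2].
have [s es] : exists s, head e = vspl s.
  apply: head_splitter; apply/negP => /output_head_inj/(_ ef) e_f.
  by move: eF; rewrite e_f fF.
have tef : t' e = t' f.
  have : (w f + w e) / k = t e - t f by rewrite E mulrC mulKf ?gt_eqF.
  by rewrite moved_sat // moved_fluid // mulrDl => h; lra.
have I' := invariant_moved.
have [|g hg] := N2 f s fF (etrans (esym ef) es).
  by move=> g tg gF; rewrite (inv_pass I' _ eF gF) // es.
by rewrite -tef ltNge (inv_in I') // es.
Qed.

End Step.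

Section Walk.
Variables (t : arc G -> R) (F : {set arc G}).
Hypotheses (I : invariant t F) (N : normalized t F).

(* All arcs at a splitter that is not alive are saturated and empty.  The walk has
   no exit from it and cannot enter it, so it is left out of the digraph. *)
Definition alive (s : splitter G) :=
  [exists e, (head e == vspl s) && ((e \in F) || (0 < t e))].
Definition live (v : option (splitter G)) := if v is Some s then alive s else true.

Lemma dead_in s : ~~ alive s ->
  forall e, head e = vspl s -> e \notin F /\ t e = 0.
Proof.
move=> /existsPn h e he; have := h e; rewrite he eqxx /= negb_or => /andP[-> h1].
split=> //; apply/eqP; rewrite eq_le leNgt h1.
by case/andP: (inv_cap I e).
Qed.

Lemma dead_out s : ~~ alive s ->
  forall f, tail f = vspl s -> f \notin F /\ t f = 0.
Proof.
move=> ds f tf.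
have : \sum_(e in outarcs G (vspl s)) t e = 0.
  rewrite -(inv_conserve I) big1 // => e; rewrite inE => /eqP he.
  by case: (dead_in ds he).
move=> /psumr_eq0P h.
have tf0 : t f = 0 by apply: h; [move=> e _; case/andP: (inv_cap I e)|rewrite inE tf].
split=> //; apply/negP => fF.
have [e he] := splitter_head_ex s.
have := inv_pass I (etrans he (esym tf)) (proj1 (dead_in ds he)) fF.
by rewrite tf0 => /eqP; rewrite eq_sym oner_eq0.
Qed.

Lemma usable_live_src e : usable t F e -> live (src F e).
Proof.
rewrite /usable /src; case: ifP => eF.
  move=> u; case te: (tail e) => [[i|s]|o] //=.
  have [//|/dead_out/(_ e te)[]] := boolP (alive s).
  by rewrite eF.
case he: (head e) => [[i|s]|o] //=; rewrite ?andbF // andbT => te.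
by apply/existsP; exists e; rewrite he eqxx te orbT.
Qed.

Lemma usable_live_dst e : usable t F e -> live (dst F e).
Proof.
rewrite /usable /dst; case: ifP => eF u.
  case he: (head e) => [[i|s]|o] //=.
  by apply/existsP; exists e; rewrite he eqxx eF.
case te: (tail e) => [[i|s]|o] //=.
have [//|/dead_out/(_ e te)[_ h]] := boolP (alive s).
by move: u; rewrite h ltxx.
Qed.

Lemma alive_exit s : alive s -> exists2 e, usable t F e & src F e = Some s.
Proof.
case/existsP => e0 /andP[/eqP he0 h0].
have [/existsP[f /and3P[/eqP tf fF ft]]|/existsPn hout] :=
    boolP [exists f, [&& tail f == vspl s, f \in F & t f < 1]].
  exists f; last by rewrite /src fF tf.
  rewrite /usable fF; have [fo|fo] := boolP (is_output (head f)).
    by apply: (proj1 N) => //; rewrite tf.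
  by rewrite cap_spl // tf.
have closed f : tail f = vspl s -> f \in F -> 1 <= t f.
  by move=> tf fF; move: (hout f); rewrite tf eqxx fF /= leNgt.
case: (@arg_maxP _ _ _ e0 (fun e => head e == vspl s) t); first by apply/eqP.
move=> e /eqP he emax.
have eF : e \notin F.
  apply/negP => eF; have [f hf] := proj2 N e s eF he closed.
  by rewrite ltNge; apply/negP/negPn/emax/eqP.
exists e; last by rewrite /src (negPf eF) he.
rewrite /usable (negPf eF) he andbT ltNge; apply/negP => te0.
case/orP: h0 => [e0F|]; last first.
  by rewrite ltNge; apply/negP/negPn/(le_trans _ te0)/emax/eqP.
have [f hf] := proj2 N e0 s e0F he0 closed.
rewrite ltNge => /negP; apply; apply: (@le_trans _ _ (t e)); first exact/emax/eqP.
by apply: (le_trans te0); case/andP: (inv_cap I e0).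
Qed.


Variables (vs : seq (option (splitter G))) (es : seq (arc G)).
Hypotheses (vs_uniq : uniq (None :: vs)) (es_uniq : uniq es).
Hypothesis mem_vs : forall v, (v \in None :: vs) = live v.
Hypothesis mem_es : forall e, (e \in es) = usable t F e.

Definition walk_label v : 'I_(size vs).+1 := inord (index v (None :: vs)).

Definition walk_arcs : {ffun 'I_(size es) -> 'I_(size vs).+1 * 'I_(size vs).+1} :=
  [ffun q => (walk_label (src F (tnth (in_tuple es) q)), walk_label (dst F (tnth (in_tuple es) q)))].

Definition walk_deg v := count (fun e => src F e == v) es.

Definition walk_weight (p : 'I_(size vs).+1 -> R) e :=
  if usable t F e then p (walk_label (src F e)) / (walk_deg (src F e))%:R else 0.

Lemma val_label v : live v -> walk_label v = index v (None :: vs) :> nat.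
Proof. by rewrite -mem_vs -index_mem => h; rewrite inordK. Qed.

Lemma labelK v : live v -> nth None (None :: vs) (walk_label v) = v.
Proof. by move=> lv; rewrite val_label // nth_index // mem_vs. Qed.

Lemma label_nth (i : 'I_(size vs).+1) : walk_label (nth None (None :: vs) i) = i.
Proof.
by rewrite /walk_label index_uniq ?inord_val // ltn_ord.
Qed.

Lemma live_nth (i : 'I_(size vs).+1) : live (nth None (None :: vs) i).
Proof. by rewrite -mem_vs mem_nth // ltn_ord. Qed.

Lemma eq_label u v : live u -> live v -> (walk_label u == walk_label v) = (u == v).
Proof.
by move=> lu lv; apply/eqP/eqP => [h|->//]; rewrite -(labelK lu) h labelK.
Qed.

Lemma sum_walk_arcs (P : pred (arc G)) (f : arc G -> R) :
  \sum_(q < size es | P (tnth (in_tuple es) q)) f (tnth (in_tuple es) q)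
  = \sum_(e | usable t F e && P e) f e.
Proof.
rewrite -(big_tnth _ _ es P f) -big_filter big_uniq ?filter_uniq //=.
by apply: eq_bigl => e; rewrite mem_filter mem_es andbC.
Qed.

Lemma usable_tnth q : usable t F (tnth (in_tuple es) q).
Proof. by rewrite -mem_es (tnth_nth (tnth (in_tuple es) q)) mem_nth. Qed.

Lemma card_out_walk_arcs v : live v ->
  #|outarcs (ord_digraph walk_arcs) (walk_label v)| = walk_deg v.
Proof.
move=> lv; rewrite /walk_deg -sum1_count (big_tnth _ _ es) -sum1_card.
apply: eq_bigl => q; rewrite inE /= ffunE /= eq_label //.
exact/usable_live_src/usable_tnth.
Qed.

Lemma live_exit v : (exists2 e, usable t F e & src F e = None) ->
  live v -> exists2 e, usable t F e & src F e = v.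
Proof. by case: v => [s _ /alive_exit|]. Qed.

Lemma walk_deg_gt0 e : usable t F e -> (0 < walk_deg (src F e))%N.
Proof. by move=> u; rewrite -has_count; apply/hasP; exists e; rewrite ?mem_es. Qed.

Lemma walkable_walk_arcs : (exists2 e, usable t F e & src F e = None) ->
  walkable (ord_digraph walk_arcs).
Proof.
move=> ex; rewrite /walkable card_ord /=; apply/forallP => i.
rewrite -(label_nth i) -card_gt0 card_out_walk_arcs ?live_nth //.
by have [e u <-] := live_exit ex (live_nth i); apply: walk_deg_gt0.
Qed.

Lemma subgraph_walk_arcs : subgraph_orientation (merged G) (ord_digraph walk_arcs).
Proof.
apply/existsP; exists [ffun i : 'I_(size vs).+1 => nth None (None :: vs) i].
apply/existsP; exists [ffun q => tnth (in_tuple es) q].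
apply/and3P; split.
- apply/injectiveP => i j; rewrite !ffunE => /eqP; rewrite nth_uniq //.
  by move/eqP/val_inj.
- by apply/injectiveP => i j; rewrite !ffunE => /tuple_uniqP h; apply: h.
apply/forallP => q; rewrite !ffunE /= !ffunE.
have u := usable_tnth q.
rewrite !labelK ?usable_live_src ?usable_live_dst //.
by rewrite /src /dst; case: ifP; rewrite !eqxx ?orbT.
Qed.

Lemma time_walk_arcs (slv : solver R) : (exists2 e, usable t F e & src F e = None) ->
  (time slv walk_arcs <= sd slv (merged G))%N.
Proof.
move=> ex; rewrite /sd.
have hn : ((size vs).+1 < #|{: option (splitter G)}|.+1)%N.
  by rewrite ltnS -[X in (X <= _)%N]/(size (None :: vs)) -(card_uniqP vs_uniq) max_card.
have hm : (size es < #|arc (merged G)|.+1)%N.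
  by rewrite ltnS -(card_uniqP es_uniq) max_card.
apply: (leq_trans _ (leq_bigmax (Ordinal hn))).
apply: (leq_trans _ (leq_bigmax (Ordinal hm))).
apply: (leq_bigmax_cond walk_arcs) => //=.
by rewrite walkable_walk_arcs //= subgraph_walk_arcs.
Qed.

Lemma stationary_sum (V : finType) (H : digraph V) (p : V -> R) v :
  \sum_u p u * walk_prob H R u v
  = \sum_(q : arc H | head q == v) p (tail q) / #|outarcs H (tail q)|%:R.
Proof.
rewrite (partition_big (@tail _ H) predT) //=; apply: eq_bigr => u _.
rewrite (eq_bigr (fun=> p u / #|outarcs H u|%:R)); last by move=> q /andP[_ /eqP->].
rewrite sumr_const /walk_prob -[RHS]mulr_natr [RHS]mulrAC -mulrA; congr (_ * (_%:R / _)).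
by apply: eq_card => q; rewrite !inE andbC.
Qed.

Variable p : 'I_(size vs).+1 -> R.
Hypothesis exit0 : exists2 e, usable t F e & src F e = None.
Hypothesis p_stationary : stationary (ord_digraph walk_arcs) p.

Lemma walk_weight_out v : live v -> \sum_(e | src F e == v) walk_weight p e = p (walk_label v).
Proof.
move=> lv; rewrite (bigID (usable t F)) /= [X in _ + X]big1 ?addr0; last first.
  by move=> e /andP[_ /negPf]; rewrite /walk_weight => ->.
rewrite (eq_bigr (fun=> p (walk_label v) / (walk_deg v)%:R)); last first.
  by move=> e /andP[/eqP<- u]; rewrite /walk_weight u.
rewrite (eq_bigl (fun e => usable t F e && (src F e == v))); last by move=> e; rewrite andbC.
rewrite -(sum_walk_arcs (fun e => src F e == v)) sumr_const.
rewrite -(card_out_walk_arcs lv) (eq_card (B := outarcs (ord_digraph walk_arcs) (walk_label v))).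
  rewrite card_out_walk_arcs // -[LHS]mulr_natr divfK //.
  by have [e u <-] := live_exit exit0 lv; rewrite pnatr_eq0 -lt0n walk_deg_gt0.
move=> q; rewrite !inE /= ffunE /= eq_label //.
exact/usable_live_src/usable_tnth.
Qed.

Lemma walk_weight_in v : live v -> \sum_(e | dst F e == v) walk_weight p e = p (walk_label v).
Proof.
move=> lv; case: p_stationary => _ _ ->; rewrite stationary_sum /=.
rewrite (bigID (usable t F)) /= [X in _ + X]big1 ?addr0; last first.
  by move=> e /andP[_ /negPf]; rewrite /walk_weight => ->.
rewrite (eq_bigl (fun e => usable t F e && (dst F e == v))); last by move=> e; rewrite andbC.
rewrite -(sum_walk_arcs (fun e => dst F e == v)).
apply: eq_big => q; rewrite ffunE /=.
  by rewrite eq_label // usable_live_dst ?usable_tnth.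
move=> _; have u := usable_tnth q.
by rewrite /walk_weight u card_out_walk_arcs // usable_live_src.
Qed.

Lemma walk_weight_direction : direction t F (walk_weight p).
Proof.
have [p0 _ _] := p_stationary.
split.
- by move=> e; rewrite /walk_weight; case: ifP => // _; rewrite divr_ge0.
- by move=> e /negPf; rewrite /walk_weight => ->.
- move=> s; have [ls|ds] := boolP (live (Some s)).
    by rewrite walk_weight_in // walk_weight_out.
  rewrite !big1 // => e /eqP h; rewrite /walk_weight; case: ifP => // u; move: ds.
    by rewrite -h usable_live_src.
  by rewrite -h usable_live_dst.
- by move=> e f ue uf ef; rewrite /walk_weight ue uf ef.
Qed.

Lemma walk_weight_gt0 : exists2 e, usable t F e & 0 < walk_weight p e.
Proof.
have [p0 p1 _] := p_stationary.
have [i pi] : exists i, 0 < p i.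
  have : \sum_v p v <> 0 by rewrite p1; apply/eqP/oner_neq0.
  by case/(psumr_neq0P (fun i _ => p0 i)) => i /andP[_]; exists i.
have [e u se] := live_exit exit0 (live_nth i).
exists e => //; rewrite /walk_weight u divr_gt0 ?ltr0n ?walk_deg_gt0 //.
by rewrite se label_nth.
Qed.

End Walk.
End Balance.

(** * Running time logic for the RAM *)

Fixpoint straight (p : cmd) : bool :=
  match p with
  | Skip | NSet _ _ _ | RSet _ _ _ => true
  | Seq p1 p2 | If _ p1 p2 => straight p1 && straight p2
  | While _ _ | Stationary _ _ _ _ _ => false
  end.

Fixpoint cost (p : cmd) : nat :=
  match p with
  | Seq p1 p2 => cost p1 + cost p2
  | If _ p1 p2 => (cost p1 + cost p2).+1
  | _ => 1
  end.

Fixpoint nmods (p : cmd) : seq nat :=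
  match p with
  | NSet a _ _ => [:: a]
  | Seq p1 p2 | If _ p1 p2 => nmods p1 ++ nmods p2
  | While _ p1 => nmods p1
  | _ => [::]
  end.

Fixpoint rmods (p : cmd) : seq nat :=
  match p with
  | RSet a _ _ => [:: a]
  | Seq p1 p2 | If _ p1 p2 => rmods p1 ++ rmods p2
  | While _ p1 => rmods p1
  | Stationary _ _ _ _ r => [:: r]
  | _ => [::]
  end.

Definition nvar a := NGet a (NConst 0).

Definition For i (bound : nexp) (body : cmd) : cmd :=
  Seq (NSet i (NConst 0) (NConst 0))
    (While (NLe (NAdd (nvar i) (NConst 1)) bound)
       (Seq body (NSet i (NConst 0) (NAdd (nvar i) (NConst 1))))).

Section Logic.
Variables (R : realType) (slv : solver R).
Implicit Types (st : state R) (p : cmd) (Q : state R -> Prop).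

Fixpoint run p st : state R :=
  match p with
  | NSet a i e => State (upd (nmem st) a (neval st i) (neval st e)) (rmem st)
  | RSet a i e => State (nmem st) (upd (rmem st) a (neval st i) (reval st e))
  | Seq p1 p2 => run p2 (run p1 st)
  | If b p1 p2 => if beval st b then run p1 st else run p2 st
  | _ => st
  end.

Lemma exec_run p st : straight p -> exists2 k, k <= cost p & exec slv p st (run p st) k.
Proof.
elim: p st => //=.
- by move=> st _; exists 1 => //; constructor.
- by move=> a i e st _; exists 1 => //; constructor.
- by move=> a i e st _; exists 1 => //; constructor.
- move=> p1 IH1 p2 IH2 st /andP[s1 s2].
  have [k1 h1 e1] := IH1 st s1; have [k2 h2 e2] := IH2 (run p1 st) s2.
  by exists (k1 + k2); [apply: leq_add|apply: ExecSeq e1 e2].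
- move=> b p1 IH1 p2 IH2 st /andP[s1 s2].
  have [k1 h1 e1] := IH1 st s1; have [k2 h2 e2] := IH2 st s2.
  exists (if beval st b then k1 else k2).+1; last by constructor; case: ifP.
  by rewrite ltnS; case: ifP => _;
    [apply: leq_trans h1 (leq_addr _ _)|apply: leq_trans h2 (leq_addl _ _)].
Qed.

Definition frame (na ra : seq nat) st st' : Prop :=
  (forall a j, a \notin na -> nmem st' a j = nmem st a j) /\
  (forall a j, a \notin ra -> rmem st' a j = rmem st a j).

Lemma frame_refl na ra st : frame na ra st st.
Proof. by []. Qed.

Lemma frame_trans na ra st1 st2 st3 :
  frame na ra st1 st2 -> frame na ra st2 st3 -> frame na ra st1 st3.
Proof.
move=> [n1 r1] [n2 r2]; split=> a j h; first by rewrite n2 // n1.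
by rewrite r2 // r1.
Qed.

Lemma frame_sub na ra na' ra' st1 st2 : {subset na <= na'} -> {subset ra <= ra'} ->
  frame na ra st1 st2 -> frame na' ra' st1 st2.
Proof.
move=> sn sr [n r]; split=> a j h; first by apply: n; apply: contra h => /sn.
by apply: r; apply: contra h => /sr.
Qed.

Lemma exec_frame p st st' k : exec slv p st st' k -> frame (nmods p) (rmods p) st st'.
Proof.
elim=> {p st st' k} //=.
- move=> st a i e; split=> //= b j; rewrite inE /upd.
  by case: (b == a).
- move=> st a i e; split=> //= b j; rewrite inE /upd.
  by case: (b == a).
- move=> p1 p2 st1 st2 st3 k1 k2 _ h1 _ h2; apply: frame_trans.
    by apply: frame_sub h1 => a; rewrite mem_cat => ->.
  by apply: frame_sub h2 => a; rewrite mem_cat orbC => ->.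
- move=> b p1 p2 st st' k _ h; case: (beval st b) h => h;
  by apply: frame_sub h => a; rewrite mem_cat => ->; rewrite ?orbT.
- by move=> b p st1 st2 st3 k1 k2 _ _ h1 _ h2; apply: frame_trans h1 h2.
- move=> st en em at_ ah r n m a _ _ _; split=> //= b j; rewrite inE => /negPf->.
  by [].
Qed.

Definition ok p st (k : nat) Q : Prop :=
  exists st' k', [/\ exec slv p st st' k', k' <= k & Q st'].

Lemma ok_weaken p st k k' Q Q' : k <= k' -> (forall st', Q st' -> Q' st') ->
  ok p st k Q -> ok p st k' Q'.
Proof.
move=> kk QQ [st' [l [e h q]]]; exists st', l; split=> //; last exact: QQ.
exact: leq_trans h kk.
Qed.

Lemma ok_seq p1 p2 st k1 k2 Q1 Q : ok p1 st k1 Q1 ->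
  (forall st1, Q1 st1 -> ok p2 st1 k2 Q) -> ok (Seq p1 p2) st (k1 + k2) Q.
Proof.
move=> [st1 [l1 [e1 h1 q1]]] /(_ _ q1)[st2 [l2 [e2 h2 q2]]].
by exists st2, (l1 + l2); split; [apply: ExecSeq e1 e2|apply: leq_add|].
Qed.

Lemma ok_run p st Q : straight p -> Q (run p st) -> ok p st (cost p) Q.
Proof. by move=> /(exec_run st)[k h e] q; exists (run p st), k. Qed.

Lemma ok_if b p1 p2 st k Q : ok (if beval st b then p1 else p2) st k Q ->
  ok (If b p1 p2) st k.+1 Q.
Proof. by move=> [st' [l [e h q]]]; exists st', l.+1; split=> //; constructor. Qed.

Lemma ok_frame p st k Q : ok p st k Q ->
  ok p st k (fun st' => frame (nmods p) (rmods p) st st' /\ Q st').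
Proof.
by move=> [st' [l [e h q]]]; exists st', l; split=> //; split=> //; apply: exec_frame e.
Qed.

Lemma ok_while b p (B n : nat) st (Inv : nat -> state R -> Prop) :
  (forall n st, Inv n st -> beval st b -> exists2 n', n = n'.+1 & ok p st B (Inv n')) ->
  Inv n st ->
  ok (While b p) st (n * B.+1 + 1) (fun st' => (exists n', Inv n' st') /\ ~~ beval st' b).
Proof.
move=> step; elim: n st => [|n IH] st inv.
  have [bt|bf] := boolP (beval st b); first by have [n'] := step _ _ inv bt.
  by exists st, 1; split; [constructor| |split; [exists 0|]].
have [bt|bf] := boolP (beval st b); last first.
  exists st, 1; split; [by constructor|by rewrite leq_addl|].
  by split; [exists n.+1|].
have [n' [<-] [st1 [k1 [e1 h1 inv1]]]] := step _ _ inv bt.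
have [st2 [k2 [e2 h2 q2]]] := IH _ inv1.
exists st2, (k1 + k2).+1; split=> //; first exact: ExecWhile e1 e2.
by rewrite mulSn -addnA addSn ltnS leq_add.
Qed.

Definition for_next i k st : state R := State (upd (nmem st) i 0 k) (rmem st).

Lemma ok_for i a j (N : nat) body st0 (Inv : nat -> state R -> Prop) :
  straight body -> i \notin nmods body -> a \notin i :: nmods body ->
  nmem st0 a j = N ->
  Inv 0 (for_next i 0 st0) ->
  (forall k st, k < N -> frame (i :: nmods body) (rmods body) st0 st ->
     nmem st i 0 = k -> Inv k st -> Inv k.+1 (for_next i k.+1 (run body st))) ->
  ok (For i (NGet a (NConst j)) body) st0 (N * (cost body + 2) + 2)
     (fun st => frame (i :: nmods body) (rmods body) st0 st /\ Inv N st).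
Proof.
move=> sb ib ab aN inv0 step.
have -> : N * (cost body + 2) + 2 = 1 + (N * (cost body + 1).+1 + 1).
  by rewrite !addn2 !addn1 add1n.
apply: (ok_seq (Q1 := eq (for_next i 0 st0))).
  by exists (for_next i 0 st0), 1; split=> //; constructor.
move=> st1 <-.
pose I n st := [/\ n + nmem st i 0 = N, frame (i :: nmods body) (rmods body) st0 st
                 & Inv (nmem st i 0) st].
have bound st : frame (i :: nmods body) (rmods body) st0 st ->
    beval st (NLe (NAdd (nvar i) (NConst 1)) (NGet a (NConst j))) = (nmem st i 0 < N).
  by move=> [fr _] /=; rewrite (fr a) // aN addn1.
have I0 : I N (for_next i 0 st0).
  rewrite /I /= {1 2}/upd !eqxx addn0; split=> //.
  split=> //= b l; rewrite inE negb_or => /andP[/negPf bi _].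
  by rewrite /upd bi.
apply: ok_weaken (leqnn _) _ (ok_while (B := cost body + 1) _ I0).
  move=> st [[n [nN fr inv]]]; rewrite bound // -leqNgt => Nk; split=> //.
  suff -> : N = nmem st i 0 by [].
  by apply/eqP; rewrite eqn_leq Nk -nN leq_addl.
move=> n st [nN fr inv]; rewrite bound // => kN.
case: n nN => [nN|n nN]; first by move: kN; rewrite -nN ltnn.
exists n => //; apply: (ok_seq (Q1 := eq (run body st))); first exact: ok_run.
move=> st1' <-; apply: (ok_run (p := NSet _ _ _)) => //=.
have [l _ /exec_frame[h h']] := exec_run st sb.
rewrite /I /= /upd !eqxx /= h // addn1; split.
- by rewrite addnS -addSn.
- apply: frame_trans fr _; split=> b m /=; last exact: h'.
  by rewrite inE negb_or => /andP[/negPf-> bb]; rewrite h.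
- exact: step kN fr erefl inv.
Qed.

End Logic.

(** * The program *)

(* Memory layout: natural arrays 0-3 and real arrays 0-1 are those of the
   input and output conventions; CAP to DEG are real arrays, the others natural. *)
Local Notation LIST := 4.    (* arcs that are not direct *)
Local Notation INS := 5.     (* cells 2v and 2v+1: arcs into the vertex v *)
Local Notation OUTS := 6.    (* cells 2v and 2v+1: arcs out of the vertex v *)
Local Notation INCNT := 7.
Local Notation OUTCNT := 8.
Local Notation LABEL := 9.   (* number of a vertex in the walk; terminals are all z, numbered 0 *)
Local Notation WTAIL := 10.
Local Notation WHEAD := 11.
Local Notation CNT := 12.
Local Notation LEN := 13.
Local Notation CHANGED := 14.
Local Notation OPEN := 15.
Local Notation NV := 16.
Local Notation NA := 17.
Local Notation CAP := 2.
Local Notation PI := 3.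
Local Notation RATE := 4.
Local Notation KAPPA := 5.
Local Notation DEG := 6.

Definition cnt := nvar CNT.
Definition n_in := NGet 0 (NConst 0).
Definition out_base := NAdd n_in (NGet 0 (NConst 1)).
Definition tail_of e := NGet 1 e.
Definition head_of e := NGet 2 e.
Definition flow e := RGet 1 e.
Definition cap_of e := RGet CAP e.
Definition rate e := RGet RATE e.
Definition kappa := RGet KAPPA (NConst 0).
Definition in_b v := NLe (NAdd v (NConst 1)) n_in.
Definition out_b v := NLe out_base v.
Definition fluid e := NLe (NConst 1) (NGet 3 e).
Definition RLt x y := BNot (RLe y x).
Definition cur := NGet LIST cnt.
Definition spl := NAdd n_in cnt.
Definition in1 := NGet INS (NAdd spl spl).
Definition in2 := NGet INS (NAdd (NAdd spl spl) (NConst 1)).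
Definition out1 := NGet OUTS (NAdd spl spl).
Definition out2 := NGet OUTS (NAdd (NAdd spl spl) (NConst 1)).
Definition label v := NGet LABEL v.

Definition cap_body :=
  Seq (RSet CAP cnt ROne) (Seq
  (If (in_b (tail_of cnt)) (RSet CAP cnt (RGet 0 (tail_of cnt))) Skip)
  (If (BAnd (out_b (head_of cnt)) (RLe (RGet 0 (head_of cnt)) (cap_of cnt)))
      (RSet CAP cnt (RGet 0 (head_of cnt))) Skip)).

Definition flow_body :=
  If (BAnd (in_b (tail_of cnt)) (out_b (head_of cnt)))
    (Seq (RSet 1 cnt (cap_of cnt))
         (If (RLe (RGet 0 (tail_of cnt)) (RGet 0 (head_of cnt)))
             (NSet 3 cnt (NConst 1)) Skip))
    (Seq (NSet 3 cnt (NConst 1)) (Seq (NSet LIST (nvar LEN) cnt)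
         (NSet LEN (NConst 0) (NAdd (nvar LEN) (NConst 1))))).

Definition push arr len v :=
  Seq (NSet arr (NAdd (NAdd v v) (NGet len v)) cnt)
      (NSet len v (NAdd (NGet len v) (NConst 1))).

Definition adj_body := Seq (push INS INCNT (head_of cnt)) (push OUTS OUTCNT (tail_of cnt)).

Definition open_body :=
  If (BAnd (BAnd (fluid cur) (in_b (tail_of cur))) (RLt (flow cur) (cap_of cur)))
     (NSet OPEN (NConst 0) (NConst 1)) Skip.

Definition saturate e := Seq (NSet 3 e (NConst 0)) (NSet CHANGED (NConst 0) (NConst 1)).

Definition sat_out_body :=
  If (BAnd (BAnd (fluid cur) (out_b (head_of cur))) (RLe (cap_of cur) (flow cur)))
     (saturate cur) Skip.

Definition closed e := BNot (BAnd (fluid e) (RLt (flow e) ROne)).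

Definition sat_in e f :=
  If (BAnd (BAnd (fluid e) (RLe (flow f) (flow e))) (BAnd (closed out1) (closed out2)))
     (saturate e) Skip.

Definition sat_in_body := Seq (sat_in in1 in2) (sat_in in2 in1).

Definition drained e := BAnd (BNot (fluid e)) (RLe (flow e) RZero).

Definition label_body :=
  If (BAnd (drained in1) (drained in2)) Skip
    (Seq (NSet LABEL spl (nvar NV)) (Seq (RSet DEG (nvar NV) RZero)
         (NSet NV (NConst 0) (NAdd (nvar NV) (NConst 1))))).

Definition forward e := BAnd (fluid e) (RLt (flow e) (cap_of e)).
Definition backward e :=
  BAnd (BNot (fluid e)) (BAnd (RLt RZero (flow e)) (BNot (out_b (head_of e)))).

Definition add_move u v :=
  Seq (NSet WTAIL (nvar NA) (label u)) (Seq (NSet WHEAD (nvar NA) (label v)) (Seq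
    (RSet DEG (label u) (RAdd (RGet DEG (label u)) ROne))
    (NSet NA (NConst 0) (NAdd (nvar NA) (NConst 1))))).

Definition walk_body :=
  If (forward cur) (add_move (tail_of cur) (head_of cur))
    (If (backward cur) (add_move (head_of cur) (tail_of cur)) Skip).

Definition raise q := If (RLe q kappa) Skip (RSet KAPPA (NConst 0) q).

Definition weight v := RDiv (RGet PI (label v)) (RGet DEG (label v)).

Definition rate_body :=
  If (forward cur)
    (Seq (RSet RATE cur (weight (tail_of cur)))
         (raise (RDiv (rate cur) (RSub (cap_of cur) (flow cur)))))
    (If (backward cur)
       (Seq (RSet RATE cur (RSub RZero (weight (head_of cur))))
            (raise (RDiv (RSub RZero (rate cur)) (flow cur))))
       (RSet RATE cur RZero)).

Definition pair_raise e f :=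
  If (BAnd (BNot (fluid e)) (fluid f))
     (raise (RDiv (RSub (rate f) (rate e)) (RSub (flow e) (flow f)))) Skip.

Definition pair_body := Seq (pair_raise in1 in2) (pair_raise in2 in1).

Definition move_body := RSet 1 cur (RAdd (flow cur) (RDiv (rate cur) kappa)).

Definition for_arcs body := For CNT (NGet LEN (NConst 0)) body.
Definition for_splitters body := For CNT (NGet 0 (NConst 1)) body.
Definition for_all_arcs body := For CNT (NGet 0 (NConst 3)) body.

Definition zero a := NSet a (NConst 0) (NConst 0).

Definition prepare :=
  Seq (for_all_arcs cap_body) (Seq (for_all_arcs flow_body) (for_all_arcs adj_body)).
Definition check := Seq (zero OPEN) (for_arcs open_body).
Definition pass := Seq (zero CHANGED) (Seq (for_arcs sat_out_body) (for_splitters sat_in_body)).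
Definition build :=
  Seq (Seq (NSet NV (NConst 0) (NConst 1)) (Seq (RSet DEG (NConst 0) RZero) (zero NA)))
      (Seq (for_splitters label_body) (for_arcs walk_body)).
Definition step :=
  Seq build (Seq (Stationary (nvar NV) (nvar NA) WTAIL WHEAD PI)
    (Seq (RSet KAPPA (NConst 0) RZero)
      (Seq (for_arcs rate_body) (Seq (for_splitters pair_body) (for_arcs move_body))))).
Definition round :=
  Seq (Seq pass (If (NLe (NConst 1) (nvar CHANGED)) Skip step)) check.
Definition main :=
  Seq prepare (Seq check (While (NLe (NConst 1) (nvar OPEN)) round)).

(** * Verification *)

Lemma take_enum (T : finType) (x : T) :
  take (enum_rank x).+1 (enum T) = rcons (take (enum_rank x) (enum T)) x.
Proof.
by rewrite (take_nth x) ?nth_enum_rank // -cardE ltn_ord.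
Qed.

Lemma mem_take_enum (T : finType) (x : T) k : (x \in take k (enum T)) = (enum_rank x < k).
Proof.
rewrite in_take ?mem_enum // -[in index _ _](nth_enum_rank x x) index_uniq ?enum_uniq //.
by rewrite -cardE ltn_ord.
Qed.

Lemma enum_rank_ex (T : finType) k : k < #|T| -> exists x : T, enum_rank x = k :> nat.
Proof. by move=> h; exists (enum_val (Ordinal h)); rewrite enum_valK. Qed.

Lemma take_split (T : eqType) (s : seq T) k : k < size s -> exists x,
  [/\ x \in s, take k.+1 s = rcons (take k s) x &
      forall f : T -> nat, nth 0 (map f s) k = f x].
Proof.
case: s => [|x0 s] // h; exists (nth x0 (x0 :: s) k); split; first exact: mem_nth.
  exact: take_nth.
by move=> f; rewrite (nth_map x0).
Qed.

Section Codes.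
Variable G : splitter_network.
Implicit Types (e : arc G) (v : vertex G).

Lemma vertex_code_input v : (vertex_code v + 1 <= #|input G|) = is_input v.
Proof.
case: v => [[i|s]|o] /=; rewrite addn1 ?ltn_ord //; apply/negbTE; rewrite -leqNgt.
  exact: leq_addr.
by rewrite -addnA leq_addr.
Qed.

Lemma vertex_code_output v : (#|input G| + #|splitter G| <= vertex_code v) = is_output v.
Proof.
case: v => [[i|s]|o] /=; last by rewrite leq_addr.
  by apply/negbTE; rewrite -ltnNge ltn_addr // ltn_ord.
by apply/negbTE; rewrite -ltnNge ltn_add2l ltn_ord.
Qed.

Lemma vertex_code_inj : injective (@vertex_code G).
Proof.
move=> u v h.
have := vertex_code_input u; rewrite h vertex_code_input.
have := vertex_code_output u; rewrite h vertex_code_output.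
case: u v h => [[i|s]|o] [[i'|s']|o'] //= h _ _.
- by move/val_inj/enum_rank_inj: h => ->.
- by move/addnI/val_inj/enum_rank_inj: h => ->.
- by move/addnI/val_inj/enum_rank_inj: h => ->.
Qed.

Lemma arc_code_inj : injective (@arc_code G).
Proof. by move=> e f /val_inj/enum_rank_inj. Qed.

Definition direct e := is_input (tail e) && is_output (head e).
Definition arcs : seq (arc G) := [seq e <- enum (arc G) | ~~ direct e].

Lemma arcs_uniq : uniq arcs.
Proof. by rewrite filter_uniq ?enum_uniq. Qed.

Lemma mem_arcs e : (e \in arcs) = ~~ direct e.
Proof. by rewrite mem_filter mem_enum andbT. Qed.

End Codes.

Section Run.
Variables (R : realType) (st : state R).

Lemma run_nset a i e :
  run (NSet a i e) st = State (upd (nmem st) a (neval st i) (neval st e)) (rmem st).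
Proof. by []. Qed.
Lemma run_rset a i e :
  run (RSet a i e) st = State (nmem st) (upd (rmem st) a (neval st i) (reval st e)).
Proof. by []. Qed.
Lemma run_seq p q : run (Seq p q) st = run q (run p st).
Proof. by []. Qed.
Lemma run_if b p q : run (If b p q) st = if beval st b then run p st else run q st.
Proof. by []. Qed.
Lemma run_skip : run Skip st = st.
Proof. by []. Qed.
Lemma beval_and b b' : beval st (BAnd b b') = beval st b && beval st b'.
Proof. by []. Qed.
Lemma beval_not b : beval st (BNot b) = ~~ beval st b.
Proof. by []. Qed.
Lemma beval_rle x y : beval st (RLe x y) = (reval st x <= reval st y)%R.
Proof. by []. Qed.
Lemma beval_rlt x y : beval st (RLt x y) = (reval st x < reval st y)%R.
Proof. by rewrite /RLt /= -ltNge. Qed.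
End Run.

Definition runE := (run_nset, run_rset, run_seq, run_if, run_skip).
Definition bevalE := (beval_and, beval_not, beval_rle, beval_rlt).

Section Passes.
Variables (R : realType) (G : splitter_network) (c : input G + output G -> R).
Implicit Types (st : state R) (e f : arc G) (v : vertex G) (s : splitter G).

Local Notation T := (@out_throughput R G).
Local Notation F := (@out_fluid R G).

Record adjacent st : Prop := Adjacent {
  adj_in : forall s, exists e f, [/\ inarcs G (vspl s) = [set e; f],
    nmem st INS (vertex_code (vspl s) + vertex_code (vspl s)) = arc_code e &
    nmem st INS (vertex_code (vspl s) + vertex_code (vspl s) + 1) = arc_code f];
  adj_out : forall s, exists e f, [/\ outarcs G (vspl s) = [set e; f],
    nmem st OUTS (vertex_code (vspl s) + vertex_code (vspl s)) = arc_code e &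
    nmem st OUTS (vertex_code (vspl s) + vertex_code (vspl s) + 1) = arc_code f]
}.

Record input_data st : Prop := InputData {
  dat_in : nmem st 0 0 = #|input G|;
  dat_spl : nmem st 0 1 = #|splitter G|;
  dat_arc : nmem st 0 3 = #|arc G|;
  dat_tail : forall e, nmem st 1 (arc_code e) = vertex_code (tail e);
  dat_head : forall e, nmem st 2 (arc_code e) = vertex_code (head e)
}.

Record env st : Prop := Env {
  env_data : input_data st;
  env_adj : adjacent st;
  env_len : nmem st LEN 0 = size (arcs G);
  env_list : forall k, k < size (arcs G) -> nmem st LIST k = nth 0 (map (@arc_code G) (arcs G)) k;
  env_cap : forall e, rmem st CAP (arc_code e) = cap c e
}.

Lemma input_data_frame na ra st st' : frame na ra st st' ->
  all (fun a => a \notin na) [:: 0; 1; 2] -> input_data st -> input_data st'.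
Proof.
move=> [fn _] /and4P[n0 n1 n2 _] [*]; split; by move=> *; rewrite fn.
Qed.

Lemma env_frame na ra st st' : frame na ra st st' ->
  all (fun a => a \notin na) [:: 0; 1; 2; LIST; INS; OUTS; LEN] -> CAP \notin ra ->
  env st -> env st'.
Proof.
move=> fr h rc [d [ai ao] el ei ec].
have [fn fr'] := fr.
move: (h) => /=; do 7!case/andP=> ?; move=> _.
split=> //.
- by apply: input_data_frame fr _ d; rewrite /=; apply/and4P.
- split=> s.
    by have [e [f [h1 h2 h3]]] := ai s; exists e, f; rewrite !fn.
  by have [e [f [h1 h2 h3]]] := ao s; exists e, f; rewrite !fn.
- by rewrite fn.
- by move=> k kn; rewrite fn // ei.
- by move=> e; rewrite fr' // ec.
Qed.

Lemma T_frame na ra st st' : frame na ra st st' -> 1 \notin ra -> T st' = T st.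
Proof. by move=> [_ fr] h; apply: funext => e; rewrite /out_throughput fr. Qed.

Lemma F_frame na ra st st' : frame na ra st st' -> 3 \notin na -> F st' = F st.
Proof. by move=> [fr _] h; apply/setP => e; rewrite !inE fr. Qed.

Section Eval.
Variables (st : state R) (x : nexp).

Lemma neval_tail e : input_data st -> neval st x = arc_code e ->
  neval st (tail_of x) = vertex_code (tail e).
Proof. by move=> d /= ->; rewrite (dat_tail d). Qed.

Lemma neval_head e : input_data st -> neval st x = arc_code e ->
  neval st (head_of x) = vertex_code (head e).
Proof. by move=> d /= ->; rewrite (dat_head d). Qed.

Lemma beval_in v : input_data st -> neval st x = vertex_code v ->
  beval st (in_b x) = is_input v.
Proof. by move=> d /= ->; rewrite (dat_in d) vertex_code_input. Qed.

Lemma beval_out v : input_data st -> neval st x = vertex_code v ->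
  beval st (out_b x) = is_output v.
Proof. by move=> d /= ->; rewrite (dat_in d) (dat_spl d) vertex_code_output. Qed.

Lemma beval_fluid e : neval st x = arc_code e -> beval st (fluid x) = (e \in F st).
Proof. by move=> /= ->; rewrite inE lt0n. Qed.

Lemma reval_flow e : neval st x = arc_code e -> reval st (flow x) = T st e.
Proof. by move=> /= ->. Qed.

Lemma reval_cap e : env st -> neval st x = arc_code e -> reval st (cap_of x) = cap c e.
Proof. by move=> E /= ->; rewrite (env_cap E). Qed.

End Eval.

Lemma env_cur k st : env st -> nmem st CNT 0 = k -> k < size (arcs G) ->
  exists e, [/\ neval st cur = arc_code e, e \in arcs G &
                take k.+1 (arcs G) = rcons (take k (arcs G)) e].
Proof.
move=> E hk kn; have [e [eI etake en]] := take_split kn.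
by exists e; split=> //=; rewrite hk (env_list E) // en.
Qed.

Lemma env_spl k st : env st -> nmem st CNT 0 = k -> k < #|splitter G| ->
  exists s, [/\ neval st spl = vertex_code (vspl s), enum_rank s = k :> nat &
                take k.+1 (enum (splitter G)) = rcons (take k (enum (splitter G))) s].
Proof.
move=> E hk /enum_rank_ex[s sk]; exists s; split=> //; last by rewrite -sk take_enum.
by rewrite /= (dat_in (env_data E)) hk sk.
Qed.

Lemma neval_ins st s : env st -> neval st spl = vertex_code (vspl s) -> exists e f,
  [/\ inarcs G (vspl s) = [set e; f], neval st in1 = arc_code e & neval st in2 = arc_code f].
Proof.
move=> E h; have [e [f [h1 h2 h3]]] := adj_in (env_adj E) s; exists e, f.
by split; rewrite // -?h2 -?h3 -h.
Qed.

Lemma neval_outs st s : env st -> neval st spl = vertex_code (vspl s) -> exists e f,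
  [/\ outarcs G (vspl s) = [set e; f], neval st out1 = arc_code e & neval st out2 = arc_code f].
Proof.
move=> E h; have [e [f [h1 h2 h3]]] := adj_out (env_adj E) s; exists e, f.
by split; rewrite // -?h2 -?h3 -h.
Qed.

Definition open_input st e :=
  [&& e \in F st, is_input (tail e) & (T st e < cap c e)%R].

Lemma ok_for_arcs slv body st0 (Inv : seq (arc G) -> state R -> Prop) :
  straight body -> CNT \notin nmods body ->
  all (fun a => a \notin CNT :: nmods body) [:: 0; 1; 2; LIST; INS; OUTS; LEN] ->
  CAP \notin rmods body -> env st0 ->
  Inv [::] (for_next CNT 0 st0) ->
  (forall l e st k, e \in arcs G -> e \notin l -> env st ->
     frame (CNT :: nmods body) (rmods body) st0 st -> neval st cur = arc_code e ->
     Inv l st -> Inv (rcons l e) (for_next CNT k (run body st))) ->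
  ok slv (for_arcs body) st0 (size (arcs G) * (cost body + 2) + 2)
    (fun st => frame (CNT :: nmods body) (rmods body) st0 st /\ Inv (arcs G) st).
Proof.
move=> sb hb hn hr E0 inv0 istep.
apply: ok_weaken (leqnn _) _ (@ok_for R slv CNT LEN 0 (size (arcs G)) body st0
  (fun k => Inv (take k (arcs G))) sb hb _ (env_len E0) _ _).
- by move=> st' [fr]; rewrite take_size.
- by move: hn => /=; do 7!case/andP=> ?.
- by rewrite take0.
move=> k st kn fr hk inv.
have E : env st by apply: env_frame fr _ _ E0.
have [e [ce eI tk]] := env_cur E hk kn.
rewrite tk; apply: istep => //.
have := take_uniq k.+1 (arcs_uniq G).
by rewrite tk rcons_uniq => /andP[].
Qed.

Lemma ok_for_splitters slv body st0 (Inv : seq (splitter G) -> state R -> Prop) :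
  straight body -> CNT \notin nmods body ->
  all (fun a => a \notin CNT :: nmods body) [:: 0; 1; 2; LIST; INS; OUTS; LEN] ->
  CAP \notin rmods body -> env st0 ->
  Inv [::] (for_next CNT 0 st0) ->
  (forall l s st k, s \notin l -> env st ->
     frame (CNT :: nmods body) (rmods body) st0 st -> neval st spl = vertex_code (vspl s) ->
     Inv l st -> Inv (rcons l s) (for_next CNT k (run body st))) ->
  ok slv (for_splitters body) st0 (#|splitter G| * (cost body + 2) + 2)
    (fun st => frame (CNT :: nmods body) (rmods body) st0 st /\ Inv (enum (splitter G)) st).
Proof.
move=> sb hb hn hr E0 inv0 istep.
apply: ok_weaken (leqnn _) _ (@ok_for R slv CNT 0 1 #|splitter G| body st0
  (fun k => Inv (take k (enum (splitter G)))) sb hb _ (dat_spl (env_data E0)) _ _).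
- by move=> st' [fr]; rewrite take_oversize // -cardE.
- by move: hn => /=; do 7!case/andP=> ?.
- by rewrite take0.
move=> k st kn fr hk inv.
have E : env st by apply: env_frame fr _ _ E0.
have [s [cs sk tk]] := env_spl E hk kn.
rewrite tk; apply: istep => //.
by rewrite mem_take_enum sk ltnn.
Qed.

Lemma ok_then slv p q st k Q : straight p ->
  (frame (nmods p) (rmods p) st (run p st) -> ok slv q (run p st) k Q) ->
  ok slv (Seq p q) st (cost p + k) Q.
Proof.
move=> sp h; have [l _ /exec_frame/h hq] := exec_run slv st sp.
by apply: (ok_seq (Q1 := eq (run p st))); [apply: ok_run|move=> _ <-].
Qed.

Lemma ok_check slv st : env st ->
  ok slv check st (1 + (size (arcs G) * (cost open_body + 2) + 2))
    (fun st' => frame (nmods check) (rmods check) st st' /\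
                nmem st' OPEN 0 = has (open_input st) (arcs G)).
Proof.
move=> E; apply: ok_frame; apply: ok_then => // fr0.
set st0 := run _ _ in fr0 *.
have E0 : env st0 by apply: env_frame fr0 _ _ E.
apply: ok_weaken (leqnn _) _ (@ok_for_arcs slv open_body st0
  (fun l st' => nmem st' OPEN 0 = has (open_input st) l) _ _ _ _ E0 _ _) => //.
  by move=> st' [].
move=> l e st' k eI el E' fr ce inv.
rewrite has_rcons /open_body run_if !bevalE (beval_fluid ce).
rewrite (beval_in (env_data E') (neval_tail (env_data E') ce)) (reval_flow ce) (reval_cap E' ce).
rewrite (F_frame fr) // (T_frame fr) // (F_frame fr0) // (T_frame fr0) // -andbA -/(open_input st e).
by case: (open_input st e) => // ->.
Qed.

Definition phi (t : arc G -> R) (A : {set arc G}) := \sum_(e <- arcs G) rank c t A e.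

Lemma rank_le3 t A e : rank c t A e <= 3.
Proof. by rewrite /rank; case: ifP => _; case: (_ <= _)%R. Qed.

Lemma phi_bound t A : phi t A <= 3 * size (arcs G).
Proof.
rewrite /phi -sum1_size big_distrr /=; apply: leq_sum => e _; exact: rank_le3.
Qed.

Lemma phi_lt t t' A A' e : e \in arcs G -> (forall e, rank c t A e <= rank c t' A' e) ->
  rank c t A e < rank c t' A' e -> phi t A < phi t' A'.
Proof.
move=> eI h he; rewrite /phi !(big_rem e eI) /= -addSn leq_add //.
by apply: leq_sum.
Qed.

Lemma phi_saturate t (A : {set arc G}) e : e \in A -> e \in arcs G -> phi t A < phi t (A :\ e).
Proof.
move=> eA eI; apply: (phi_lt eI) => [f|]; last first.
  by rewrite /rank eA !inE eqxx /= addn2; case: (_ <= _)%R.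
rewrite /rank !inE; case: eqP => //= ->; rewrite eA addn2.
by case: (_ <= _)%R.
Qed.

Definition full_output (t : arc G -> R) (A : {set arc G}) e :=
  [&& e \in A, is_output (head e) & (cap c e <= t e)%R].

Definition blocked (t : arc G -> R) (A : {set arc G}) e :=
  [&& e \in A, [forall f, (head f == head e) ==> (t f <= t e)%R] &
      [forall f, (tail f == head e) ==> (f \in A) ==> (1 <= t f)%R]].

Lemma normalizedP t A : (forall e, e \in arcs G -> ~~ full_output t A e) ->
  (forall e s, head e = vspl s -> ~~ blocked t A e) -> normalized c t A.
Proof.
move=> h1 h2; split.
  move=> e eA ho hi; have := h1 e; rewrite mem_arcs /direct ho andbT hi => /(_ isT).
  by rewrite /full_output eA ho /= -ltNge.
move=> e s eA he hout; have := h2 e s he; rewrite /blocked eA he /= negb_and => /orP[].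
  rewrite negb_forall => /existsP[f]; rewrite negb_imply => /andP[/eqP hf].
  by rewrite -ltNge; exists f.
rewrite negb_forall => /existsP[f]; rewrite !negb_imply => /and3P[/eqP tf fA].
by rewrite hout.
Qed.

Definition pass_inv (t : arc G -> R) A0 (changed : nat) A (done : Prop) :=
  invariant c t A /\ if changed is 0 then A = A0 /\ done else phi t A0 < phi t A.

Lemma pass_inv_saturate t A0 ch A e done done' : pass_inv t A0 ch A done ->
  e \in A -> e \in arcs G -> invariant c t (A :\ e) -> pass_inv t A0 1 (A :\ e) done'.
Proof.
move=> [_ h] eA eI I; split=> //; apply: leq_ltn_trans (phi_saturate t eA eI).
case: ch h => [[-> _]|m h]; [exact: leqnn|exact: ltnW].
Qed.

Lemma F_saturate st x e : neval st x = arc_code e -> F (run (saturate x) st) = F st :\ e.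
Proof.
move=> xe; apply/setP => f; rewrite !inE /= /upd /= xe.
by rewrite (inj_eq (@arc_code_inj G)); case: (f == e).
Qed.

Lemma pass_sat_in st s x y e f g h t A0 done done' :
  input_data st -> T st = t ->
  inarcs G (vspl s) = [set e; f] -> outarcs G (vspl s) = [set g; h] ->
  neval st x = arc_code e -> neval st y = arc_code f ->
  neval st out1 = arc_code g -> neval st out2 = arc_code h ->
  (forall x, 0 <= c x <= 1)%R ->
  pass_inv t A0 (nmem st CHANGED 0) (F st) done ->
  (done -> ~~ blocked t A0 e -> done') ->
  pass_inv t A0 (nmem (run (sat_in x y) st) CHANGED 0) (F (run (sat_in x y) st)) done'.
Proof.
move=> d Tt hin hout xe yf og oh c01 inv dd.
have inE' e' : (head e' == vspl s) = (e' == e) || (e' == f).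
  by move/setP: hin => /(_ e'); rewrite !inE.
have outE e' : (tail e' == vspl s) = (e' == g) || (e' == h).
  by move/setP: hout => /(_ e'); rewrite !inE.
have he : head e = vspl s by apply/eqP; rewrite inE' eqxx.
have hg : tail g = vspl s by apply/eqP; rewrite outE eqxx.
have hh : tail h = vspl s by apply/eqP; rewrite outE eqxx orbT.
have hf : head f = vspl s by apply/eqP; rewrite inE' eqxx orbT.
rewrite /sat_in run_if.
set b := beval st _.
have bE : b = blocked t (F st) e.
  rewrite /b !bevalE (beval_fluid xe) !(reval_flow xe).
  rewrite !(reval_flow yf) !(beval_fluid og) !(beval_fluid oh) (reval_flow og) (reval_flow oh).
  rewrite /blocked Tt -andbA; congr andb; rewrite he; congr andb.
    apply/idP/forallP => [h1 e'|/(_ f)]; last by rewrite hf eqxx.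
    by apply/implyP; rewrite inE' => /orP[]/eqP-> //; rewrite lexx.
  rewrite !negb_and -!leNgt; apply/andP/forallP => [[h1 h2] e'|H].
    by apply/implyP; rewrite outE => /orP[]/eqP->; rewrite implybE.
  by split; [have := H g; rewrite hg|have := H h; rewrite hh]; rewrite eqxx /= implybE.
have [bl|nb] := boolP b.
  have eF : e \in F st by move: bl; rewrite bE => /and3P[].
  rewrite (F_saturate xe) /=; apply: (pass_inv_saturate _ inv) => //.
    by rewrite mem_arcs /direct he andbF.
  move: bl; rewrite bE /blocked he => /and3P[_ /forallP h1 /forallP h2].
  apply: (invariant_saturate_in c01 (proj1 inv) eF he) => e' te.
    by move=> e'F; have := h2 e'; rewrite te eqxx e'F.
  by have := h1 e'; rewrite te eqxx.
rewrite run_skip; move: inv => [I]; rewrite /pass_inv.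
case: (nmem st CHANGED 0) => [[FA dn]|m] //; split=> //; split=> //.
by apply: dd => //; rewrite -FA -bE.
Qed.

Definition pass_cost := 1 + ((size (arcs G) * (cost sat_out_body + 2) + 2) +
  (#|splitter G| * (cost sat_in_body + 2) + 2)).

Lemma ok_pass slv st : (forall x, 0 <= c x <= 1)%R -> env st -> invariant c (T st) (F st) ->
  ok slv pass st pass_cost
    (fun st' => frame (nmods pass) (rmods pass) st st' /\
       pass_inv (T st) (F st) (nmem st' CHANGED 0) (F st') (normalized c (T st) (F st))).
Proof.
move=> c01 E I; apply: ok_frame; apply: ok_then => // fr0.
set st0 := run _ _ in fr0 *.
have E0 : env st0 by apply: env_frame fr0 _ _ E.
have T0 : T st0 = T st by apply: T_frame fr0 _.
have F0 : F st0 = F st by apply: F_frame fr0 _.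
apply: (ok_seq (Q1 := fun st' => frame (CNT :: nmods sat_out_body) (rmods sat_out_body) st0 st' /\
   pass_inv (T st) (F st) (nmem st' CHANGED 0) (F st')
     (forall e, e \in arcs G -> ~~ full_output (T st) (F st) e))).
  apply: (@ok_for_arcs slv sat_out_body st0 (fun l st' =>
     pass_inv (T st) (F st) (nmem st' CHANGED 0) (F st')
       (forall e, e \in l -> ~~ full_output (T st) (F st) e)) _ _ _ _ E0) => //.
  move=> l e st' k eI el E' fr ce inv.
  have T' : T st' = T st by rewrite (T_frame fr).
  rewrite /sat_out_body run_if; set b := beval st' _.
  have bE : b = full_output (T st) (F st') e.
    rewrite /b !bevalE (beval_fluid ce) (reval_flow ce) (reval_cap E' ce) T'.
    by rewrite (beval_out (env_data E') (neval_head (env_data E') ce)) -andbA.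
  change (pass_inv (T st) (F st)
    (nmem (if b then run (saturate cur) st' else run Skip st') CHANGED 0)
    (F (if b then run (saturate cur) st' else run Skip st'))
    (forall e0, e0 \in rcons l e -> ~~ full_output (T st) (F st) e0)).
  have [bl|nb] := boolP b.
    move: bl; rewrite bE => /and3P[eF eo ce'].
    rewrite (F_saturate ce) /=; apply: (pass_inv_saturate _ inv) => //.
    apply: (invariant_saturate_output c01 (proj1 inv) eF eo ce').
    by move: eI; rewrite mem_arcs /direct eo andbT.
  rewrite run_skip; move: inv => [I']; rewrite /pass_inv.
  case: (nmem st' CHANGED 0) => [[FA dn]|m] //; split=> //; split=> // e'.
  by rewrite mem_rcons inE => /orP[/eqP->|/dn//]; rewrite -FA -bE.
move=> st1 [fr1 inv1].
have E1 : env st1 by apply: env_frame fr1 _ _ E0.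
have T1 : T st1 = T st by rewrite (T_frame fr1).
apply: ok_weaken (leqnn _) _ (@ok_for_splitters slv sat_in_body st1 (fun l st' =>
   pass_inv (T st) (F st) (nmem st' CHANGED 0) (F st')
     ((forall e, e \in arcs G -> ~~ full_output (T st) (F st) e) /\
      (forall e s, s \in l -> head e = vspl s -> ~~ blocked (T st) (F st) e))) _ _ _ _ E1 _ _) => //.
- move=> st' [_ [I' h]]; split=> //; case: (nmem st' CHANGED 0) h => // -[-> [h1 h2]].
  split=> //; apply: normalizedP => // e s; apply: h2; exact: mem_enum.
- move: inv1 => [I1 h1]; split=> //; move: h1.
  rewrite -[nmem (for_next _ _ _) _ _]/(nmem st1 CHANGED 0).
  by case: (nmem st1 CHANGED 0) => [[F1 h]|m] //; split.
move=> l s st' k _ E' fr cs inv.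
have [e [f [hin ce cf]]] := neval_ins E' cs.
have [g [h [hout cg ch]]] := neval_outs E' cs.
have T' : T st' = T st by rewrite (T_frame fr).
rewrite /sat_in_body run_seq.
have inv' := pass_sat_in (done' := (forall e, e \in arcs G -> ~~ full_output (T st) (F st) e) /\
   (forall e s, s \in l -> head e = vspl s -> ~~ blocked (T st) (F st) e) /\
   ~~ blocked (T st) (F st) e) (env_data E') T' hin hout ce cf cg ch c01 inv.
have {inv'} inv' := inv' (fun d b => conj (proj1 d) (conj (proj2 d) b)).
have [l1 _ /exec_frame fr2] := exec_run slv st' (isT : straight (sat_in in1 in2)).
set st2 := run _ st' in inv' fr2 *.
have spl2 : neval st2 spl = vertex_code (vspl s) by rewrite -cs /= !(proj1 fr2).
have E2 : env st2 by apply: env_frame fr2 _ _ E'.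
have ce2 : neval st2 in1 = arc_code e by rewrite -ce /= !(proj1 fr2).
have cf2 : neval st2 in2 = arc_code f by rewrite -cf /= !(proj1 fr2).
have cg2 : neval st2 out1 = arc_code g by rewrite -cg /= !(proj1 fr2).
have ch2 : neval st2 out2 = arc_code h by rewrite -ch /= !(proj1 fr2).
have T2 : T st2 = T st by rewrite (T_frame fr2).
rewrite setUC in hin.
apply: (pass_sat_in (env_data E2) T2 hin hout cf2 ce2 cg2 ch2 c01 inv').
move=> [h1 [h2 h3]] h4; split=> // e' s'; rewrite mem_rcons inE => /orP[/eqP->|]; last exact: h2.
move/setP: hin => /(_ e'); rewrite !inE => hin he'.
by move: hin; rewrite he' eqxx => /esym/orP[]/eqP->.
Qed.

End Passes.

Section Build.
Variables (R : realType) (G : splitter_network) (c : input G + output G -> R).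
Implicit Types (st : state R) (e f : arc G) (v : vertex G) (s : splitter G).
Local Notation T := (@out_throughput R G).
Local Notation F := (@out_fluid R G).

(* Terminals are merged into z, which has label 0. *)
Definition labels_zero st :=
  forall v, ~~ is_splitter v -> nmem st LABEL (vertex_code v) = 0.

Definition live_list (t : arc G -> R) A (l : seq (splitter G)) : seq (option (splitter G)) :=
  [seq Some s | s <- l & alive t A s].

Record labelled (t : arc G -> R) A (l : seq (splitter G)) st : Prop := Labelled {
  lab_zero : labels_zero st;
  lab_size : nmem st NV 0 = (size (live_list t A l)).+1;
  lab_index : forall s, s \in l -> alive t A s ->
    nmem st LABEL (vertex_code (vspl s)) = index (Some s) (None :: live_list t A l);
  lab_deg : forall i, i < (size (live_list t A l)).+1 -> rmem st DEG i = 0%R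
}.

Lemma mem_live_list t A l s : (Some s \in live_list t A l) = alive t A s && (s \in l).
Proof. by rewrite mem_map ?mem_filter // => ? ? []. Qed.

Lemma beval_dead st s e f : invariant c (T st) (F st) ->
  inarcs G (vspl s) = [set e; f] ->
  neval st in1 = arc_code e -> neval st in2 = arc_code f ->
  beval st (BAnd (drained in1) (drained in2)) = ~~ alive (T st) (F st) s.
Proof.
move=> I hin ce cf; rewrite !bevalE (beval_fluid ce) (beval_fluid cf).
rewrite (reval_flow ce) (reval_flow cf) -[reval st RZero]/(0%R).
have inE' e' : (head e' == vspl s) = (e' == e) || (e' == f).
  by move/setP: hin => /(_ e'); rewrite !inE.
apply/andP/idP => [[/andP[h1 h2] /andP[h3 h4]]|].
  rewrite negb_exists; apply/forallP => e'; rewrite inE'.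
  case: eqP => [->|_] /=; first by rewrite negb_or h1 -leNgt h2.
  by case: eqP => [->|_] //=; rewrite negb_or h3 -leNgt h4.
rewrite negb_exists => /forallP h; have := h e; have := h f.
rewrite !inE' !eqxx orbT /= !negb_or -!leNgt => /andP[-> ->] /andP[-> ->].
by [].
Qed.

Lemma labelled_step t A l s st k : t = T st -> A = F st -> invariant c t A -> s \notin l ->
  env c st -> neval st spl = vertex_code (vspl s) -> labelled t A l st ->
  labelled t A (rcons l s) (for_next CNT k (run label_body st)).
Proof.
move=> -> -> I sl E cs [lz ls li ld].
have [e [f [hin ce cf]]] := neval_ins E cs.
rewrite /label_body run_if (beval_dead I hin ce cf).
have [al|dead] /= := boolP (alive (T st) (F st) s); last first.
  split=> //.
  - by rewrite /live_list filter_rcons (negPf dead).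
  - move=> s'; rewrite mem_rcons inE => /orP[/eqP->|]; first by rewrite (negPf dead).
    by rewrite /live_list filter_rcons (negPf dead); exact: li.
  - by rewrite /live_list filter_rcons (negPf dead).
have lE : live_list (T st) (F st) (rcons l s) = rcons (live_list (T st) (F st) l) (Some s).
  by rewrite /live_list filter_rcons al map_rcons.
have cs' : nmem st 0 0 + nmem st 12 0 = vertex_code (vspl s) by [].
rewrite /nvar /= in ls *.
split.
- move=> v nv; rewrite /= /upd /= cs'.
  case: eqP => [/vertex_code_inj h|_]; last exact: lz.
  by move: nv; rewrite h.
- by rewrite /= /upd /= ls lE size_rcons addn1.
- move=> s' ; rewrite mem_rcons inE lE -rcons_cons /= /upd /= cs' => s's al'.
  rewrite /= -cats1 index_cat mem_live_list al' /=.
  have [->|ne] := eqVneq s' s.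
    by rewrite eqxx (negPf sl) /= eqxx addn0 ls.
  have s'l : s' \in l by move: s's; rewrite (negPf ne).
  case: eqP => [/(@vertex_code_inj G (vspl s') (vspl s))[ss]|_].
    by rewrite ss eqxx in ne.
  by rewrite s'l (li _ s'l al').
- move=> i; rewrite lE size_rcons ltnS leq_eqVlt /= /upd /= ls => /orP[/eqP->|h].
    by rewrite eqxx.
  by case: eqP => // _; exact: ld.
Qed.

Record walk_built (t : arc G -> R) A vs (l : seq (arc G)) st : Prop := WalkBuilt {
  wb_size : nmem st NA 0 = size [seq e <- l | usable c t A e];
  wb_tail : forall q, q < size [seq e <- l | usable c t A e] ->
    nmem st WTAIL q = nth 0 [seq index (src A e) vs | e <- l & usable c t A e] q;
  wb_head : forall q, q < size [seq e <- l | usable c t A e] ->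
    nmem st WHEAD q = nth 0 [seq index (dst A e) vs | e <- l & usable c t A e] q;
  wb_deg : forall o : option (splitter G), o \in vs ->
    rmem st DEG (index o vs) = (count (fun e => src A e == o) [seq e <- l | usable c t A e])%:R%R
}.

Lemma not_output_head e : ~~ is_output (head e) = is_splitter (head e).
Proof. by case h: (head e) => [[i|s]|o] //; case: (head_not_input h). Qed.

Lemma beval_forward st x e : env c st -> neval st x = arc_code e ->
  beval st (forward x) = (e \in F st) && usable c (T st) (F st) e.
Proof.
move=> E ce; rewrite !bevalE (beval_fluid ce) (reval_flow ce) (reval_cap E ce).
by rewrite /usable; case: ifP.
Qed.

Lemma beval_backward st x e : env c st -> neval st x = arc_code e ->
  beval st (backward x) = (e \notin F st) && usable c (T st) (F st) e.
Proof.
move=> E ce; rewrite !bevalE (beval_fluid ce) (reval_flow ce).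
rewrite (beval_out (env_data E) (neval_head (env_data E) ce)) not_output_head.
by rewrite /usable; case: ifP.
Qed.

Lemma frame_upd a i n st0 st1 na ra : a \in na -> frame na ra st0 st1 ->
  frame na ra st0 (State (upd (nmem st1) a i n) (rmem st1)).
Proof.
move=> ha [fn fr]; split=> //= b j hb; rewrite /upd.
by case: eqP => [ba|_] /=; [move: hb; rewrite ba ha|apply: fn].
Qed.

Lemma frame_updr a i x st0 st1 na ra : a \in ra -> frame na ra st0 st1 ->
  frame na ra st0 (State (nmem st1) (upd (rmem st1) a i x)).
Proof.
move=> ha [fn fr]; split=> //= b j hb; rewrite /upd.
by case: eqP => [ba|_] /=; [move: hb; rewrite ba ha|apply: fr].
Qed.

Lemma run_add_move st x y i j :
  (forall st', frame [:: WTAIL; WHEAD; NA] [:: DEG] st st' ->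
     neval st' (label x) = i /\ neval st' (label y) = j) ->
  run (add_move x y) st =
  State (upd (upd (upd (nmem st) WTAIL (nmem st NA 0) i) WHEAD (nmem st NA 0) j)
             NA 0 (nmem st NA 0 + 1))
        (upd (rmem st) DEG i (rmem st DEG i + 1)%R).
Proof.
move=> h; rewrite /add_move !runE.
have fr0 := frame_refl [:: WTAIL; WHEAD; NA] [:: DEG] st.
have fr1 := frame_upd (nmem st NA 0) i (isT : WTAIL \in [:: WTAIL; WHEAD; NA]) fr0.
have fr2 := frame_upd (nmem st NA 0) j (isT : WHEAD \in [:: WTAIL; WHEAD; NA]) fr1.
rewrite [neval st (label x)](proj1 (h _ fr0)).
rewrite [neval st (nvar NA)]/(nmem st NA 0).
set st1 := State (upd _ WTAIL _ _) _.
rewrite [neval st1 (label y)](proj2 (h _ fr1)).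
rewrite [neval st1 (nvar NA)]/(nmem st NA 0).
set st2 := State (upd _ WHEAD _ _) _.
have [hx _] := h st2 fr2.
rewrite -[reval st2 _]/(rmem st DEG (neval st2 (label x)) + 1)%R hx.
by [].
Qed.

Lemma walk_built_add t A vs l st k x y e : usable c t A e -> src A e \in vs ->
  (forall st', frame [:: WTAIL; WHEAD; NA] [:: DEG] st st' ->
     neval st' (label x) = index (src A e) vs /\ neval st' (label y) = index (dst A e) vs) ->
  walk_built t A vs l st ->
  walk_built t A vs (rcons l e) (for_next CNT k (run (add_move x y) st)).
Proof.
move=> us svs h [bs bt bh bd].
have fE : [seq e <- rcons l e | usable c t A e] = rcons [seq e <- l | usable c t A e] e.
  by rewrite filter_rcons us.
rewrite (run_add_move h); split; rewrite fE.
- by rewrite /= /upd /= bs size_rcons addn1.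
- move=> q; rewrite size_rcons map_rcons nth_rcons size_map /= /upd /= bs.
  by rewrite ltnS leq_eqVlt; case: eqP => [->|_] /=; [rewrite ltnn|move=> ql; rewrite ql bt].
- move=> q; rewrite size_rcons map_rcons nth_rcons size_map /= /upd /= bs.
  by rewrite ltnS leq_eqVlt; case: eqP => [->|_] /=; [rewrite ltnn|move=> ql; rewrite ql bh].
- move=> v vv; rewrite -cats1 count_cat /= addn0 natrD /upd /=.
  have -> : (index v vs == index (src A e) vs) = (src A e == v).
    apply/eqP/eqP => [h'|->//]; rewrite -(nth_index v vv) h' nth_index //.
  case: eqP => [<-|_]; first by rewrite bd.
  by rewrite addr0 bd.
Qed.

Lemma walk_built_skip t A vs l st k e : ~~ usable c t A e ->
  walk_built t A vs l st -> walk_built t A vs (rcons l e) (for_next CNT k st).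
Proof.
move=> us [bs bt bh bd].
have fE : [seq e <- rcons l e | usable c t A e] = [seq e <- l | usable c t A e].
  by rewrite filter_rcons (negPf us).
by split; rewrite fE.
Qed.

Definition walk_vertices t A := None :: live_list t A (enum (splitter G)).

Lemma mem_walk_vertices t A (o : option (splitter G)) :
  (o \in walk_vertices t A) = live t A o.
Proof. by case: o => [s|] //; rewrite in_cons /= mem_live_list mem_enum andbT. Qed.

Lemma walk_vertices_uniq t A : uniq (walk_vertices t A).
Proof.
rewrite /walk_vertices cons_uniq; apply/andP; split; first by apply/mapP => -[].
by rewrite map_inj_uniq; [apply/filter_uniq/enum_uniq|move=> ? ? []].
Qed.

Definition vertices_labelled t A st := forall v, live t A (merge_vertex v) ->
  nmem st LABEL (vertex_code v) = index (merge_vertex v) (walk_vertices t A).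

Lemma labelled_all t A st : labelled t A (enum (splitter G)) st -> vertices_labelled t A st.
Proof.
move=> [lz _ li _] [[i|s]|o] lv; [exact: lz| |exact: lz].
by apply: (li s); rewrite ?mem_enum.
Qed.

Lemma walk_body_step t A l st k e : t = T st -> A = F st ->
  (forall x, 0 <= c x <= 1)%R -> env c st ->
  invariant c t A -> normalized c t A -> neval st cur = arc_code e ->
  vertices_labelled t A st ->
  walk_built t A (walk_vertices t A) l st ->
  walk_built t A (walk_vertices t A) (rcons l e) (for_next CNT k (run walk_body st)).
Proof.
move=> -> -> c01 E I N ce lab wb.
rewrite /walk_body !run_if (beval_forward E ce) (beval_backward E ce).
have [us|nu] := boolP (usable c (T st) (F st) e); last by rewrite !andbF; exact: walk_built_skip.
have ls := usable_live_src I us; have ld := usable_live_dst I us.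
rewrite !andbT; case: ifPn => eF.
  apply: walk_built_add => //; first by rewrite mem_walk_vertices.
  move=> st' [fr _]; rewrite /= !fr //.
  rewrite -[nmem st 4 _]/(neval st cur) ce (dat_tail (env_data E)) (dat_head (env_data E)).
  by rewrite !lab; rewrite /src /dst eF in ls ld *.
rewrite eF; apply: walk_built_add => //; first by rewrite mem_walk_vertices.
move=> st' [fr _]; rewrite /= !fr //.
rewrite -[nmem st 4 _]/(neval st cur) ce (dat_tail (env_data E)) (dat_head (env_data E)).
by rewrite !lab; rewrite /src /dst (negPf eF) in ls ld *.
Qed.

Definition build_cost := 3 + ((#|splitter G| * (cost label_body + 2) + 2) +
  (size (arcs G) * (cost walk_body + 2) + 2)).

Lemma ok_build slv st : (forall x, 0 <= c x <= 1)%R -> env c st -> labels_zero st ->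
  invariant c (T st) (F st) -> normalized c (T st) (F st) ->
  ok slv build st build_cost
    (fun st' => [/\ frame (nmods build) (rmods build) st st', labels_zero st',
       nmem st' NV 0 = size (walk_vertices (T st) (F st)),
       vertices_labelled (T st) (F st) st' &
       walk_built (T st) (F st) (walk_vertices (T st) (F st)) (arcs G) st']).
Proof.
move=> c01 E lz I N.
apply: (ok_weaken (leqnn _) _ (ok_frame (Q := fun st' => [/\ labels_zero st',
       nmem st' NV 0 = size (walk_vertices (T st) (F st)),
       vertices_labelled (T st) (F st) st' &
       walk_built (T st) (F st) (walk_vertices (T st) (F st)) (arcs G) st']) _)).
  by move=> st' [? []].
apply: ok_then => // fr0; set st0 := run _ st in fr0 *.
have E0 : env c st0 by apply: env_frame fr0 _ _ E.
have T0 : T st0 = T st by rewrite (T_frame G fr0).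
have F0 : F st0 = F st by rewrite (F_frame G fr0).
apply: (ok_seq (Q1 := fun st' => frame (CNT :: nmods label_body) (rmods label_body) st0 st' /\
   labelled (T st) (F st) (enum (splitter G)) st')).
  apply: (@ok_for_splitters R G c slv label_body st0 (fun l => labelled (T st) (F st) l)
    _ _ _ _ E0) => //.
    by split=> //; case.
  move=> l s st' k sl E' fr cs; apply: labelled_step => //.
    by rewrite (T_frame G fr).
  by rewrite (F_frame G fr).
move=> st1 [fr1 [lz1 ls1 li1 ld1]].
have E1 : env c st1 by apply: env_frame fr1 _ _ E0.
have T1 : T st1 = T st by rewrite (T_frame G fr1).
have F1 : F st1 = F st by rewrite (F_frame G fr1).
have lab1 : vertices_labelled (T st) (F st) st1 by apply: labelled_all.
apply: ok_weaken (leqnn _) _ (@ok_for_arcs R G c slv walk_body st1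
   (walk_built (T st) (F st) (walk_vertices (T st) (F st))) _ _ _ _ E1 _ _) => //.
- move=> st' [[fr _] wb]; split=> //.
  + by move=> v nv; rewrite fr // lz1.
  + by rewrite fr // ls1.
  + by move=> v lv; rewrite fr // lab1.
- split=> //=; first by rewrite /upd /= (proj1 fr1).
  by move=> v; rewrite -index_mem => vv; rewrite ld1.
move=> l e st' k eI el E' fr ce; apply: walk_body_step => //.
- by rewrite (T_frame G fr).
- by rewrite (F_frame G fr).
- by move=> v lv; rewrite (proj1 fr) // lab1.
Qed.

End Build.

Section Moves.
Variables (R : realType) (G : splitter_network) (c : input G + output G -> R).
Hypothesis c01 : forall x, (0 <= c x <= 1)%R.
Implicit Types (st : state R) (e f : arc G) (v : vertex G) (s : splitter G).
Local Notation T := (@out_throughput R G).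
Local Notation F := (@out_fluid R G).

Lemma usable_arcs t A e : invariant c t A -> usable c t A e -> e \in arcs G.
Proof.
move=> I; rewrite mem_arcs /direct /usable => u; apply/negP => /andP[ti ho].
move: u; case: ifP => eA; last by case: (head e) ho => [[i|s]|o] //; rewrite andbF.
by rewrite ltNge (inv_direct I ti ho eA) /cap ge_min lexx.
Qed.

Section Walk.
Variables (t : arc G -> R) (A : {set arc G}).
Hypotheses (I : invariant c t A) (N : normalized c t A).

Let vs := live_list t A (enum (splitter G)).
Let es := [seq e <- arcs G | usable c t A e].

Let vs_uniq : uniq (None :: vs).
Proof. exact: walk_vertices_uniq. Qed.
Let es_uniq : uniq es.
Proof. by rewrite filter_uniq ?arcs_uniq. Qed.
Let mem_vs (o : option (splitter G)) : (o \in None :: vs) = live t A o.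
Proof. exact: mem_walk_vertices. Qed.
Let mem_es e : (e \in es) = usable c t A e.
Proof. by rewrite mem_filter andb_idr // => u; apply: usable_arcs I u. Qed.

Definition flux (slv : solver R) e : R :=
  walk_weight c t A es (solve slv (walk_arcs A vs es)) e.

Lemma ok_stationary slv st :
  (exists2 e, usable c t A e & src A e = None) ->
  nmem st NV 0 = size (walk_vertices t A) ->
  walk_built c t A (walk_vertices t A) (arcs G) st ->
  ok slv (Stationary (nvar NV) (nvar NA) WTAIL WHEAD PI) st (sd slv (merged G)).+1
    (fun st' => [/\ frame [::] [:: PI] st st',
       direction c t A (flux slv), (exists2 e, usable c t A e & (0 < flux slv e)%R) &
       forall e, usable c t A e ->
         (rmem st' PI (index (src A e) (walk_vertices t A)) /
          rmem st' DEG (index (src A e) (walk_vertices t A)))%R = flux slv e]).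
Proof.
move=> ex0 hn [hm ht hh hd].
have wa := walkable_walk_arcs I N vs_uniq mem_vs mem_es ex0.
have sp := solveP slv wa.
exists (store st PI (solve slv (walk_arcs A vs es))), (time slv (walk_arcs A vs es)).+1.
have ex : exec slv (Stationary (nvar NV) (nvar NA) WTAIL WHEAD PI) st
    (store st PI (solve slv (walk_arcs A vs es))) (time slv (walk_arcs A vs es)).+1.
  apply: (@ExecStationary R slv st (nvar NV) (nvar NA) _ _ _ _ _ (walk_arcs A vs es) hn hm) => q.
  have u := usable_tnth mem_es q.
  have us := usable_live_src I u; have ud := usable_live_dst I u.
  rewrite ffunE /= !(val_label mem_vs) //.
  have qe : nth (tnth (in_tuple es) q) es q = tnth (in_tuple es) q.
    by rewrite [RHS](tnth_nth (tnth (in_tuple es) q)).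
  by rewrite ht ?hh ?ltn_ord // !(nth_map (tnth (in_tuple es) q)) ?ltn_ord // qe.
split=> //; first by rewrite ltnS (time_walk_arcs I N).
split.
- exact: exec_frame ex.
- exact: walk_weight_direction.
- exact: walk_weight_gt0.
move=> e u; rewrite /flux /walk_weight u.
rewrite -[X in (_ / X)%R = _]/(rmem st DEG (index (src A e) (walk_vertices t A))).
have us := usable_live_src I u.
rewrite hd ?mem_walk_vertices //; congr (_ / _)%R.
rewrite -[index (src A e) (walk_vertices t A)](val_label mem_vs us).
rewrite -[LHS]/(if insub _ is Some i then _ else _); case: insubP => [i _ iE|]; last by rewrite ltn_ord.
by congr solve; apply: val_inj.
Qed.

Variable w : arc G -> R.
Hypothesis D : direction c t A w.

Definition signed e : R := if e \in A then w e else (- w e)%R.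

Record raised (P : arc G -> Prop) (Q : arc G -> arc G -> Prop) (k : R) : Prop := Raised {
  rs_ge0 : (0 <= k)%R;
  rs_fluid : forall e, P e -> e \in A -> usable c t A e -> (w e <= k * (cap c e - t e))%R;
  rs_sat : forall e, P e -> e \notin A -> usable c t A e -> (w e <= k * t e)%R;
  rs_pair : forall e f, Q e f -> head e = head f -> e \notin A -> f \in A ->
    (w f + w e <= k * (t e - t f))%R;
  rs_tight : k = 0%R \/ step_tight c t A w k
}.

Lemma pair_lt e f : head e = head f -> e \notin A -> f \in A -> (t f < t e)%R.
Proof.
move=> ef eA fA.
have [s fs] : exists s, head f = vspl s.
  apply: head_splitter; apply/negP => /output_head_inj/(_ (esym ef)) fe.
  by move: eA; rewrite -fe fA.
have [g tg gF|g hg h] := proj2 N f s fA fs.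
  by rewrite (inv_pass I _ eA gF) // ef fs.
by apply: lt_le_trans h (inv_in I _ eA); rewrite ef fs hg.
Qed.

Lemma raised_mono (P P' : arc G -> Prop) (Q Q' : arc G -> arc G -> Prop) k k' :
  raised P Q k -> (k <= k')%R -> (k' = k \/ step_tight c t A w k') ->
  (forall e, P' e -> e \in A -> usable c t A e -> P e \/ (w e <= k' * (cap c e - t e))%R) ->
  (forall e, P' e -> e \notin A -> usable c t A e -> P e \/ (w e <= k' * t e)%R) ->
  (forall e f, Q' e f -> head e = head f -> e \notin A -> f \in A ->
     Q e f \/ (w f + w e <= k' * (t e - t f))%R) ->
  raised P' Q' k'.
Proof.
move=> [k0 kf ks kp kt] kk kE hf hs hp; split.
- exact: le_trans kk.
- move=> e Pe eA u; have [Pe'|//] := hf e Pe eA u.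
  apply: le_trans (kf e Pe' eA u) _; rewrite ler_wpM2r // subr_ge0.
  by case/andP: (inv_cap I e).
- move=> e Pe eA u; have [Pe'|//] := hs e Pe eA u.
  apply: le_trans (ks e Pe' eA u) _; rewrite ler_wpM2r //.
  by case/andP: (inv_cap I e).
- move=> e f Qef ef eA fA; have [Q0|//] := hp e f Qef ef eA fA.
  apply: le_trans (kp e f Q0 ef eA fA) _; rewrite ler_wpM2r // subr_ge0.
  exact/ltW/pair_lt.
- by case: kE => [->|]; [exact: kt|right].
Qed.

(* The value of [kappa] after the comparison with the quotient [x / y]. *)
Lemma raise_quotient (k x y : R) : (0 < y)%R ->
  let k' := if (x / y <= k)%R then k else (x / y)%R in
  [/\ (k <= k')%R, (x <= k' * y)%R & k' = k \/ x = (k' * y)%R].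
Proof.
move=> y0; case: leP => h /=; split=> //; try by left.
- by rewrite -ler_pdivrMr.
- exact: ltW.
- by rewrite divfK ?gt_eqF.
- by right; rewrite divfK ?gt_eqF.
Qed.

Lemma raised_fluid (P : arc G -> Prop) Q k e : raised P Q k -> e \in A -> usable c t A e ->
  raised (fun e' => P e' \/ e' = e) Q
    (if (w e / (cap c e - t e) <= k)%R then k else (w e / (cap c e - t e))%R).
Proof.
move=> rk eA u.
have y0 : (0 < cap c e - t e)%R by rewrite subr_gt0; move: u; rewrite /usable eA.
have [h1 h2 h3] := raise_quotient k (w e) y0.
apply: raised_mono rk h1 _ _ _ _.
- by case: h3 => h; [left|right; constructor 1; exists e; split].
- by move=> e' [Pe|->]; [left|right].
- by move=> e' [Pe|->]; [left|rewrite eA].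
- by left.
Qed.

Lemma raised_sat (P : arc G -> Prop) Q k e : raised P Q k -> e \notin A -> usable c t A e ->
  raised (fun e' => P e' \/ e' = e) Q (if (w e / t e <= k)%R then k else (w e / t e)%R).
Proof.
move=> rk eA u.
have y0 : (0 < t e)%R by move: u; rewrite /usable (negPf eA) => /andP[].
have [h1 h2 h3] := raise_quotient k (w e) y0.
apply: raised_mono rk h1 _ _ _ _.
- by case: h3 => h; [left|right; constructor 2; exists e; split].
- by move=> e' [Pe|->]; [left|rewrite (negPf eA)].
- by move=> e' [Pe|->]; [left|right].
- by left.
Qed.

Lemma raised_pair P (Q : arc G -> arc G -> Prop) k e f : raised P Q k ->
  head e = head f -> e \notin A -> f \in A ->
  raised P (fun e' f' => Q e' f' \/ e' = e /\ f' = f)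
    (if ((w f + w e) / (t e - t f) <= k)%R then k else ((w f + w e) / (t e - t f))%R).
Proof.
move=> rk ef eA fA.
have y0 : (0 < t e - t f)%R by rewrite subr_gt0 pair_lt.
have [h1 h2 h3] := raise_quotient k (w f + w e) y0.
apply: raised_mono rk h1 _ _ _ _.
- by case: h3 => h; [left|right; constructor 3; exists e, f; split].
- by left.
- by left.
- by move=> e' f' [Pe|[-> ->]]; [left|right].
Qed.

Lemma run_raise st q :
  rmem (run (raise q) st) KAPPA 0 =
    (if (reval st q <= rmem st KAPPA 0)%R then rmem st KAPPA 0 else reval st q) /\
  frame [::] [:: KAPPA] st (run (raise q) st).
Proof.
split; last first.
  rewrite /raise run_if; case: ifP => _; first exact: frame_refl.
  by apply: (@frame_updr R KAPPA 0) => //; apply: frame_refl.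
rewrite /raise run_if beval_rle; case: ifP => //.
Qed.

Definition rated (l : seq (arc G)) st : Prop :=
  (forall e, e \in l -> rmem st RATE (arc_code e) = signed e) /\
  raised (fun e => e \in l) (fun _ _ => False) (rmem st KAPPA 0).

Definition weighted st : Prop := forall e, usable c t A e ->
  (rmem st PI (index (src A e) (walk_vertices t A)) /
   rmem st DEG (index (src A e) (walk_vertices t A)))%R = w e.

Lemma rated_add l e st st' k (x : R) : rated l st -> usable c t A e ->
  rmem st' RATE (arc_code e) = signed e ->
  (forall j, j != arc_code e -> rmem st' RATE j = rmem st RATE j) ->
  raised (fun e' => e' \in l \/ e' = e) (fun _ _ => False) (rmem st' KAPPA 0) ->
  rated (rcons l e) (for_next CNT k st').
Proof.
move=> [hr _] u he hj rs; split.
  move=> e'; rewrite mem_rcons inE /=; case: eqVneq => [->//|ne /= el].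
  by rewrite hj ?hr // (inj_eq (@arc_code_inj G)).
apply: (raised_mono rs) => //; try by left.
- by move=> e'; rewrite mem_rcons inE => /orP[/eqP->|el] _ _; left; [right|left].
- by move=> e'; rewrite mem_rcons inE => /orP[/eqP->|el] _ _; left; [right|left].
Qed.

Lemma rated_step l e st k : env c st -> t = T st -> A = F st -> neval st cur = arc_code e ->
  vertices_labelled t A st -> weighted st -> rated l st ->
  rated (rcons l e) (for_next CNT k (run rate_body st)).
Proof.
move=> E tE AE ce lab wt rt.
rewrite /rate_body !run_if (beval_forward E ce) (beval_backward E ce) -tE -AE.
have ce' : nmem st LIST (nmem st CNT 0) = arc_code e := ce.
have ct : nmem st 1 (nmem st LIST (nmem st CNT 0)) = vertex_code (tail e).
  by rewrite ce' (dat_tail (env_data E)).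
have ch : nmem st 2 (nmem st LIST (nmem st CNT 0)) = vertex_code (head e).
  by rewrite ce' (dat_head (env_data E)).
have [u|nu] := boolP (usable c t A e); last first.
  rewrite !andbF run_rset; split.
    move=> e'; rewrite mem_rcons inE /= /upd /= ce' (inj_eq (@arc_code_inj G)).
    case: eqVneq => [->|ne] /=; first by rewrite /signed (dir_usable D nu) oppr0 if_same.
    by apply: (proj1 rt).
  apply: (raised_mono (proj2 rt)) => //; try by left.
  + by move=> e'; rewrite mem_rcons inE => /orP[/eqP->|]; [rewrite (negPf nu)|left].
  + by move=> e'; rewrite mem_rcons inE => /orP[/eqP->|]; [rewrite (negPf nu)|left].
have lu := usable_live_src I u.
rewrite !andbT; case: ifPn => eA.
  rewrite run_seq run_rset ce.
  have -> : reval st (weight (tail_of cur)) = w e.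
    rewrite /= ct lab; last by move: lu; rewrite /src eA.
    by rewrite -(wt _ u) /src eA.
  set st1 := State _ _.
  have [rk [_ rr]] := run_raise st1 (RDiv (rate cur) (RSub (cap_of cur) (flow cur))).
  have E1 : env c st1 by apply: (@env_frame R G c [::] [:: RATE] st) => //; apply: frame_updr.
  have ce1 : neval st1 cur = arc_code e by [].
  have qE : reval st1 (RDiv (rate cur) (RSub (cap_of cur) (flow cur))) =
      (w e / (cap c e - t e))%R.
    rewrite -[LHS]/(reval st1 (rate cur) / (reval st1 (cap_of cur) - reval st1 (flow cur)))%R.
    rewrite (reval_cap E1 ce1) (reval_flow ce1) tE; congr (_ / _)%R.
    by rewrite /= /upd /= ce' eqxx.
  rewrite qE in rk.
  apply: (rated_add k 0%R rt u).
  - by rewrite rr //= /upd /= eqxx /signed eA.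
  - by move=> j /negPf ne; rewrite rr //= /upd /= ne.
  rewrite rk; exact: raised_fluid (proj2 rt) eA u.
rewrite eA run_seq run_rset ce.
have -> : reval st (RSub RZero (weight (head_of cur))) = (- w e)%R.
  rewrite /= ch lab; last by move: lu; rewrite /src (negPf eA).
  by rewrite -(wt _ u) /src (negPf eA) sub0r.
set st1 := State _ _.
have [rk [_ rr]] := run_raise st1 (RDiv (RSub RZero (rate cur)) (flow cur)).
have ce1 : neval st1 cur = arc_code e by [].
have qE : reval st1 (RDiv (RSub RZero (rate cur)) (flow cur)) = (w e / t e)%R.
  rewrite -[LHS]/((0 - reval st1 (rate cur)) / reval st1 (flow cur))%R.
  rewrite (reval_flow ce1) tE; congr (_ / _)%R.
  by rewrite /= /upd /= ce' eqxx opprK add0r.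
rewrite qE in rk.
apply: (rated_add k 0%R rt u).
- by rewrite rr //= /upd /= eqxx /signed (negPf eA).
- by move=> j /negPf ne; rewrite rr //= /upd /= ne.
rewrite rk; exact: raised_sat (proj2 rt) eA u.
Qed.

Definition all_rated st := forall e, e \in arcs G -> rmem st RATE (arc_code e) = signed e.

Lemma run_pair_raise st s e f x y Q : env c st -> t = T st -> A = F st -> all_rated st ->
  head e = vspl s -> head f = vspl s -> neval st x = arc_code e -> neval st y = arc_code f ->
  raised (fun e => e \in arcs G) Q (rmem st KAPPA 0) ->
  raised (fun e => e \in arcs G) (fun e' f' => Q e' f' \/ e' = e /\ f' = f)
    (rmem (run (pair_raise x y) st) KAPPA 0) /\
  frame [::] [:: KAPPA] st (run (pair_raise x y) st).
Proof.
move=> E tE AE ar he hf xe yf rs.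
rewrite /pair_raise run_if !bevalE (beval_fluid xe) (beval_fluid yf) -AE.
have eI : e \in arcs G by rewrite mem_arcs /direct he andbF.
have fI : f \in arcs G by rewrite mem_arcs /direct hf andbF.
case: ifPn => [/andP[eA fA]|h]; last first.
  split; last exact: frame_refl.
  apply: (raised_mono rs) => //; try by left.
  move=> e' f' [q|[-> ->]] _ eA fA; first by left.
  by rewrite eA fA in h.
have [rk fr] := run_raise st (RDiv (RSub (rate y) (rate x)) (RSub (flow x) (flow y))).
split=> //; rewrite rk.
have -> : reval st (RDiv (RSub (rate y) (rate x)) (RSub (flow x) (flow y))) =
    ((w f + w e) / (t e - t f))%R.
  rewrite -[LHS]/((reval st (rate y) - reval st (rate x)) /
                  (reval st (flow x) - reval st (flow y)))%R.
  rewrite (reval_flow xe) (reval_flow yf) tE; congr (_ / _)%R.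
  by rewrite /= xe yf !ar // /signed (negPf eA) fA opprK.
by apply: raised_pair => //; rewrite he.
Qed.

Lemma pair_step l s st k : env c st -> t = T st -> A = F st -> all_rated st ->
  neval st spl = vertex_code (vspl s) ->
  raised (fun e => e \in arcs G) (fun e _ => exists2 s, s \in l & head e = vspl s)
    (rmem st KAPPA 0) ->
  raised (fun e => e \in arcs G) (fun e _ => exists2 s', s' \in rcons l s & head e = vspl s')
    (rmem (for_next CNT k (run pair_body st)) KAPPA 0).
Proof.
move=> E tE AE ar cs rs.
have [e [f [hin ce cf]]] := neval_ins E cs.
have inE' e' : (head e' == vspl s) = (e' == e) || (e' == f).
  by move/setP: hin => /(_ e'); rewrite !inE.
have he : head e = vspl s by apply/eqP; rewrite inE' eqxx.
have hf : head f = vspl s by apply/eqP; rewrite inE' eqxx orbT.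
rewrite /pair_body run_seq.
have [rs1 fr1] := run_pair_raise E tE AE ar he hf ce cf rs.
set st1 := run (pair_raise in1 in2) st in rs1 fr1 *.
have E1 : env c st1 by apply: env_frame fr1 _ _ E.
have t1 : t = T st1 by rewrite (T_frame G fr1).
have A1 : A = F st1 by rewrite (F_frame G fr1).
have ar1 : all_rated st1 by move=> e' e'I; rewrite (proj2 fr1) // ar.
have ce1 : neval st1 in1 = arc_code e by rewrite -ce /= !(proj1 fr1).
have cf1 : neval st1 in2 = arc_code f by rewrite -cf /= !(proj1 fr1).
have [rs2 fr2] := run_pair_raise E1 t1 A1 ar1 hf he cf1 ce1 rs1.
apply: (raised_mono rs2) => //; try by left.
move=> e' f' [s']; rewrite mem_rcons inE => /orP[/eqP->|s'l] e's e'f' e'A f'A; left; last first.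
  by left; left; exists s'.
have /orP[/eqP e'E|/eqP e'E] : (e' == e) || (e' == f) by rewrite -inE' e's.
  have /orP[/eqP f'E|/eqP f'E] : (f' == e) || (f' == f) by rewrite -inE' -e'f' e's.
    by move: e'A; rewrite e'E -f'E f'A.
  by left; right.
have /orP[/eqP f'E|/eqP f'E] : (f' == e) || (f' == f) by rewrite -inE' -e'f' e's.
  by right.
by move: e'A; rewrite e'E -f'E f'A.
Qed.

End Walk.

Definition step_cost (slv : solver R) := build_cost G + ((sd slv (merged G)).+1 + (1 +
  ((size (arcs G) * (cost rate_body + 2) + 2) +
  ((#|splitter G| * (cost pair_body + 2) + 2) +
   (size (arcs G) * (cost move_body + 2) + 2))))).

Lemma ok_step slv st : env c st -> @labels_zero R G st ->
  invariant c (T st) (F st) -> normalized c (T st) (F st) ->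
  (exists2 e, e \in arcs G & open_input c st e) ->
  ok slv step st (step_cost slv)
    (fun st' => [/\ frame (nmods step) (rmods step) st st', @labels_zero R G st',
       invariant c (T st') (F st') &
       phi c (T st) (F st) < phi c (T st') (F st') \/
       phi c (T st) (F st) <= phi c (T st') (F st') /\ ~ normalized c (T st') (F st')]).
Proof.
move=> E lz I N [e0 _ /and3P[e0F e0i e0t]].
have ex0 : exists2 e, usable c (T st) (F st) e & src (F st) e = None.
  exists e0; first by rewrite /usable e0F.
  by rewrite /src e0F; case: (tail e0) e0i => [[]|].
apply: (ok_weaken (leqnn _) _ (ok_frame (Q := fun st' => [/\ @labels_zero R G st',
       invariant c (T st') (F st') &
       phi c (T st) (F st) < phi c (T st') (F st') \/
       phi c (T st) (F st) <= phi c (T st') (F st') /\ ~ normalized c (T st') (F st')]) _)).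
  by move=> st' [? []].
apply: (ok_seq (ok_build slv c01 E lz I N)) => st1 [fr1 lz1 nv1 lab1 wb1].
have E1 : env c st1 by apply: env_frame fr1 _ _ E.
have T1 : T st1 = T st by rewrite (T_frame G fr1).
have F1 : F st1 = F st by rewrite (F_frame G fr1).
apply: (ok_seq (ok_stationary I N slv ex0 nv1 wb1)) => st2 [fr2 D [ew uw w0] wt2].
set w := flux (T st) (F st) slv in D w0 wt2.
have E2 : env c st2 by apply: env_frame fr2 _ _ E1.
have T2 : T st2 = T st by rewrite (T_frame G fr2).
have F2 : F st2 = F st by rewrite (F_frame G fr2).
apply: ok_then => // fr3; set st3 := run _ st2 in fr3 *.
have E3 : env c st3 by apply: env_frame fr3 _ _ E2.
have T3 : T st3 = T st by rewrite (T_frame G fr3).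
have F3 : F st3 = F st by rewrite (F_frame G fr3).
have lab3 : vertices_labelled (T st) (F st) st3.
  by move=> v lv; rewrite (proj1 fr3) // (proj1 fr2) // lab1.
have wt3 : weighted (T st) (F st) w st3.
  by move=> e u; rewrite !(proj2 fr3) // wt2.
apply: (ok_seq (Q1 := fun st' => frame (CNT :: nmods rate_body) (rmods rate_body) st3 st' /\
   rated (T st) (F st) w (arcs G) st')).
  apply: (@ok_for_arcs R G c slv rate_body st3 (rated (T st) (F st) w) _ _ _ _ E3) => //.
    split=> //=; split=> //; rewrite /upd //=; by left.
  move=> l e st' k eI el E' fr ce; apply: rated_step => //.
  - by rewrite (T_frame G fr).
  - by rewrite (F_frame G fr).
  - by move=> v lv; rewrite (proj1 fr) // lab3.
  - by move=> e' u; rewrite !(proj2 fr) // wt3.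
move=> st4 [fr4 [ar4 rs4]].
have E4 : env c st4 by apply: env_frame fr4 _ _ E3.
have T4 : T st4 = T st by rewrite (T_frame G fr4).
have F4 : F st4 = F st by rewrite (F_frame G fr4).
apply: (ok_seq (Q1 := fun st' => frame (CNT :: nmods pair_body) (rmods pair_body) st4 st' /\
   raised (T st) (F st) w (fun e => e \in arcs G)
     (fun e _ => exists2 s, s \in enum (splitter G) & head e = vspl s) (rmem st' KAPPA 0))).
  apply: (@ok_for_splitters R G c slv pair_body st4 (fun l st' =>
   raised (T st) (F st) w (fun e => e \in arcs G)
     (fun e _ => exists2 s, s \in l & head e = vspl s) (rmem st' KAPPA 0)) _ _ _ _ E4) => //.
    apply: (raised_mono I N rs4) => //; try by left.
    by move=> e f [].
  move=> l s st' k sl E' fr cs; apply: pair_step => //.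
  - by rewrite (T_frame G fr).
  - by rewrite (F_frame G fr).
  - by move=> e eI; rewrite (proj2 fr) // ar4.
move=> st5 [fr5 rs5].
have E5 : env c st5 by apply: env_frame fr5 _ _ E4.
have T5 : T st5 = T st by rewrite (T_frame G fr5).
have F5 : F st5 = F st by rewrite (F_frame G fr5).
have ar5 : all_rated (F st) w st5 by move=> e eI; rewrite (proj2 fr5) // ar4.
set k := rmem st5 KAPPA 0 in rs5.
have k0 : (0 < k)%R.
  case: rs5 => k0 kf ks _ _; rewrite lt_neqAle k0 andbT; apply/negP => /eqP kE.
  have uI := usable_arcs I uw.
  have [eA|eA] := boolP (ew \in F st).
    by have := kf _ uI eA uw; rewrite -kE mul0r leNgt w0.
  by have := ks _ uI eA uw; rewrite -kE mul0r leNgt w0.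
have B : step_bound c (T st) (F st) w k.
  case: rs5 => _ kf ks kp _; split=> //.
  - by move=> e eA u; apply: kf => //; apply: usable_arcs I u.
  - by move=> e eA u; apply: ks => //; apply: usable_arcs I u.
  - move=> e f ef eA fA; apply: kp => //.
    have [|s es] := @head_splitter G e.
      by apply/negP => /output_head_inj/(_ ef) e_f; move: eA; rewrite e_f fA.
    by exists s => //; rewrite mem_enum.
have tight : step_tight c (T st) (F st) w k.
  by case: (rs_tight rs5) => // kE; move: k0; rewrite kE ltxx.
pose t' := moved (T st) (F st) w k.
apply: ok_weaken (leqnn _) _ (@ok_for_arcs R G c slv move_body st5 (fun l st' =>
  forall e, T st' e = if e \in l then t' e else T st e) _ _ _ _ E5 _ _) => //.
- move=> st' [fr h].
  have T' : T st' = t'.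
    apply: funext => e; rewrite h; case: ifPn => // eI.
    rewrite /t' /moved (dir_usable D) ?oppr0 ?if_same ?mul0r ?addr0 //.
    by apply: contra eI; apply: usable_arcs.
  have F' : F st' = F st by rewrite (F_frame G fr).
  rewrite T' F'; split.
  + move=> v nv; rewrite (proj1 fr) // (proj1 fr5) // (proj1 fr4) // (proj1 fr3) //.
    by rewrite (proj1 fr2) // lz1.
  + exact: (invariant_moved c01 I N D B).
  + have rm e := rank_moved D B e.
    case: (moved_tight c01 I N D B tight) => [[e lt_e u]|nn]; [left|right].
      exact: phi_lt (usable_arcs I u) rm lt_e.
    by split=> //; rewrite /phi; apply: leq_sum => e _; apply: rm.
- by move=> e; rewrite -T5.
move=> l e st' m eI el E' fr ce h e'.
have T'E : T st' e = T st e by rewrite h (negPf el).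
rewrite mem_rcons inE /move_body run_rset ce.
have -> : reval st' (RAdd (flow cur) (RDiv (rate cur) kappa)) = t' e.
  rewrite -[LHS]/(reval st' (flow cur) + rmem st' RATE (neval st' cur) / rmem st' KAPPA 0)%R.
  by rewrite (reval_flow ce) T'E ce !(proj2 fr) // ar5.
rewrite /out_throughput /= /upd /= (inj_eq (@arc_code_inj G)).
by case: eqVneq => [->//|_] /=; rewrite -h.
Qed.

End Moves.

Section Prepare.
Variables (R : realType) (G : splitter_network) (c : input G + output G -> R).
Hypothesis c01 : forall x, (0 <= c x <= 1)%R.
Implicit Types (st : state R) (e f : arc G) (v : vertex G) (s : splitter G).
Local Notation T := (@out_throughput R G).
Local Notation F := (@out_fluid R G).

Lemma arc_arrayE (h : arc G -> nat) e : arc_array h (arc_code e) = h e.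
Proof.
rewrite /arc_array; case: pickP => [f /eqP/arc_code_inj->//|/(_ e)].
by rewrite eqxx.
Qed.

Lemma terminal_code_inj : injective (@terminal_code G).
Proof. by move=> [i|o] [i'|o'] /vertex_code_inj // [->]. Qed.

Definition capacity_data st := forall x, rmem st 0 (terminal_code x) = c x.

Lemma init_data : input_data G (init_state c).
Proof. by split=> // e; apply: arc_arrayE. Qed.

Lemma init_capacity : capacity_data (init_state c).
Proof.
move=> x /=; case: pickP => [y /eqP/terminal_code_inj->//|/(_ x)].
by rewrite eqxx.
Qed.

Lemma ok_for_all_arcs slv body st0 (Inv : seq (arc G) -> state R -> Prop) :
  straight body -> CNT \notin nmods body ->
  all (fun a => a \notin CNT :: nmods body) [:: 0; 1; 2] -> 0 \notin rmods body ->
  input_data G st0 -> capacity_data st0 ->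
  Inv [::] (for_next CNT 0 st0) ->
  (forall l e st k, e \notin l -> uniq l -> input_data G st -> capacity_data st ->
     frame (CNT :: nmods body) (rmods body) st0 st -> neval st cnt = arc_code e ->
     Inv l st -> Inv (rcons l e) (for_next CNT k (run body st))) ->
  ok slv (for_all_arcs body) st0 (#|arc G| * (cost body + 2) + 2)
    (fun st => [/\ frame (CNT :: nmods body) (rmods body) st0 st,
       input_data G st, capacity_data st & Inv (enum (arc G)) st]).
Proof.
move=> sb hb hn hr d0 c0 inv0 istep.
have dat st : frame (CNT :: nmods body) (rmods body) st0 st ->
    input_data G st /\ capacity_data st.
  move=> fr; split; first exact: input_data_frame fr hn d0.
  by move=> x; rewrite (proj2 fr) // c0.
apply: ok_weaken (leqnn _) _ (@ok_for R slv CNT 0 3 #|arc G| body st0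
  (fun k => Inv (take k (enum (arc G)))) sb hb _ (dat_arc d0) _ _).
- by move=> st' [fr]; have [? ?] := dat _ fr; rewrite take_oversize // -cardE.
- by move: hn => /=; case/and3P=> ?.
- by rewrite take0.
move=> k st kn fr hk inv; have [d1 c1] := dat _ fr.
have [e ek] := enum_rank_ex kn.
rewrite -ek take_enum ek; apply: istep => //.
- by rewrite mem_take_enum ek ltnn.
- exact: take_uniq (enum_uniq _).
- by rewrite /= hk -ek.
Qed.

Lemma cap_body_spec st e l k : input_data G st -> capacity_data st ->
  neval st cnt = arc_code e ->
  (forall f, f \in l -> rmem st CAP (arc_code f) = cap c f) ->
  forall f, f \in rcons l e -> rmem (for_next CNT k (run cap_body st)) CAP (arc_code f) = cap c f.
Proof.
move=> d cd ce h f.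
have ce' : nmem st CNT 0 = arc_code e := ce.
have ct := neval_tail d ce; have ch := neval_head d ce.
suff [h1 h2] : rmem (run cap_body st) CAP (arc_code e) = cap c e /\
    forall j, j != arc_code e -> rmem (run cap_body st) CAP j = rmem st CAP j.
  rewrite mem_rcons inE; case: eqVneq => [-> _|ne /= fl]; first exact: h1.
  by rewrite -[LHS]/(rmem (run cap_body st) CAP (arc_code f)) h2 ?h // (inj_eq (@arc_code_inj G)).
rewrite /cap_body !run_seq run_rset ce.
set st1 := State _ _.
have d1 : input_data G st1 by case: d; split.
have cd1 : capacity_data st1 by move=> x; rewrite -[LHS]/(rmem st 0 (terminal_code x)) cd.
have ce1 : neval st1 cnt = arc_code e := ce.
have ct1 := neval_tail d1 ce1.
set st2 := run (If (in_b _) _ _) st1.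
have st2E : st2 = if is_input (tail e)
    then State (nmem st1) (upd (rmem st1) CAP (arc_code e) (rmem st1 0 (vertex_code (tail e))))
    else st1.
  by rewrite /st2 run_if (beval_in d1 ct1) run_rset run_skip ce1 -ct1.
have r2 : rmem st2 CAP (arc_code e) = cap_in c (tail e).
  rewrite st2E; case te: (tail e) => [[i|s]|o] /=; rewrite /upd /= eqxx //.
  by rewrite (cd (inl i)).
have o2 j : j != arc_code e -> rmem st2 CAP j = rmem st CAP j.
  by move=> /negPf ne; rewrite st2E; case: ifP => _ /=; rewrite /upd /= ne.
have n2 : nmem st2 = nmem st by rewrite st2E; case: ifP.
have cd2 : capacity_data st2.
  move=> x; rewrite -(cd x) st2E; by case: ifP.
have d2 : input_data G st2 by case: d; split; rewrite n2.
have ce2 : neval st2 cnt = arc_code e by rewrite /= n2.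
have ch2 := neval_head d2 ce2.
have -> : run (If (BAnd (out_b (head_of cnt)) (RLe (RGet 0 (head_of cnt)) (cap_of cnt)))
      (RSet CAP cnt (RGet 0 (head_of cnt))) Skip) st2 =
    if is_output (head e) && (rmem st2 0 (vertex_code (head e)) <= cap_in c (tail e))%R
    then State (nmem st2) (upd (rmem st2) CAP (arc_code e) (rmem st2 0 (vertex_code (head e))))
    else st2.
  rewrite run_if bevalE (beval_out d2 ch2) beval_rle run_rset ce2.
  rewrite -[reval st2 (RGet 0 _)]/(rmem st2 0 (neval st2 (head_of cnt))) ch2.
  by rewrite -[reval st2 (cap_of _)]/(rmem st2 CAP (neval st2 cnt)) ce2 r2.
split; last by move=> j ne; case: ifP => _; rewrite /= ?o2 // /upd /= (negPf ne) o2.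
rewrite /cap; case he: (head e) => [[i|s]|o] /=.
- by case: (head_not_input he).
- by rewrite r2 min_l //; case/andP: (cap_in01 c01 (tail e)).
rewrite (cd2 (inr o)); case: leP => h'; rewrite /= ?r2 ?/upd //=.
by rewrite eqxx.
Qed.

Definition direct_fluid e := ~~ direct e || (cap_in c (tail e) <= cap_out c (head e))%R.

Record started (l : seq (arc G)) st : Prop := Started {
  std_len : nmem st LEN 0 = size [seq e <- l | ~~ direct e];
  std_list : forall q, q < size [seq e <- l | ~~ direct e] ->
    nmem st LIST q = nth 0 [seq arc_code e | e <- l & ~~ direct e] q;
  std_flow : forall e, T st e = if (e \in l) && direct e then cap c e else 0%R;
  std_fluid : forall e, (e \in F st) = (e \in l) && direct_fluid e
}.

Lemma flow_body_spec st e l k : input_data G st -> capacity_data st ->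
  (forall e, rmem st CAP (arc_code e) = cap c e) ->
  neval st cnt = arc_code e -> e \notin l -> started l st ->
  started (rcons l e) (for_next CNT k (run flow_body st)).
Proof.
move=> d cd cp ce el [sn sl sf sF].
have ct := neval_tail d ce; have ch := neval_head d ce.
rewrite /flow_body run_if bevalE (beval_in d ct) (beval_out d ch) -/(direct e).
have rcE f : (f \in rcons l e) = (f == e) || (f \in l) by rewrite mem_rcons inE.
have [de|nd] := boolP (direct e).
  have fE : [seq e <- rcons l e | ~~ direct e] = [seq e <- l | ~~ direct e].
    by rewrite filter_rcons de.
  rewrite run_seq run_rset ce.
  have -> : reval st (cap_of cnt) = cap c e.
    by rewrite -[LHS]/(rmem st CAP (neval st cnt)) ce cp.
  rewrite run_if run_nset run_skip beval_rle.
  set st1 := State _ _.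
  have -> : reval st1 (RGet 0 (tail_of cnt)) = cap_in c (tail e).
    rewrite -[LHS]/(rmem st 0 (neval st (tail_of cnt))) ct.
    move: de; rewrite /direct; case: (tail e) => [[i|s]|o] //= _.
    exact: (cd (inl i)).
  have -> : reval st1 (RGet 0 (head_of cnt)) = cap_out c (head e).
    rewrite -[LHS]/(rmem st 0 (neval st (head_of cnt))) ch.
    move: de; rewrite /direct andbC; case: (head e) => [[i|s]|o] //= _.
    exact: (cd (inr o)).
  have -> : neval st1 cnt = arc_code e := ce.
  have dfE : (cap_in c (tail e) <= cap_out c (head e))%R = direct_fluid e.
    by rewrite /direct_fluid de.
  rewrite dfE; split; rewrite ?fE.
  - by case: ifP.
  - by move=> q hq; rewrite -sl //; case: ifP.
  - move=> f; have -> : T (for_next CNT k (if direct_fluid e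
        then State (upd (nmem st1) 3 (arc_code e) (neval st1 (NConst 1))) (rmem st1) else st1)) f =
        upd (rmem st) 1 (arc_code e) (cap c e) 1 (arc_code f) by case: ifP.
    rewrite /upd /= (inj_eq (@arc_code_inj G)) rcE; case: eqVneq => [->|_] /=; first by rewrite de.
    exact: sf.
  - move=> f; rewrite rcE inE /=.
    case: ifP => df; rewrite /= /upd /= ?(inj_eq (@arc_code_inj G)); case: (eqVneq f e) => [->|_] /=.
    + by rewrite df.
    + by rewrite -sF inE.
    + by rewrite df; have := sF e; rewrite (negPf el) inE.
    + by rewrite -sF inE.
have fE : [seq e <- rcons l e | ~~ direct e] = rcons [seq e <- l | ~~ direct e] e.
  by rewrite filter_rcons nd.
have ce' : nmem st CNT 0 = arc_code e := ce.
split; rewrite ?fE.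
- by rewrite /= /upd /= sn size_rcons addn1.
- move=> q; rewrite size_rcons map_rcons nth_rcons size_map /= /upd /= sn.
  by rewrite ltnS leq_eqVlt; case: eqP => [->|_] /=; [rewrite ltnn ce'|move=> ql; rewrite ql sl].
- move=> f; rewrite rcE -[LHS]/(T st f) sf; case: eqVneq => [->|//].
  by rewrite (negPf nd) !andbF.
- move=> f; rewrite rcE inE /= /upd /= ce' (inj_eq (@arc_code_inj G)).
  by case: (eqVneq f e) => [->|_] /=; [rewrite /direct_fluid nd|rewrite -sF inE].
Qed.

Definition listed arr len (h : arc G -> vertex G) (l : seq (arc G)) st := forall v,
  nmem st len (vertex_code v) = size [seq e <- l | h e == v] /\
  forall q, q < size [seq e <- l | h e == v] ->
    nmem st arr (vertex_code v + vertex_code v + q) = nth 0 [seq arc_code e | e <- l & h e == v] q.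

Lemma listed_push arr len h l st e x : arr != len ->
  (forall v, size [seq e <- rcons l e | h e == v] <= 2) ->
  neval st cnt = arc_code e -> neval st x = vertex_code (h e) ->
  (forall i n, neval (State (upd (nmem st) arr i n) (rmem st)) x = vertex_code (h e)) ->
  listed arr len h l st -> listed arr len h (rcons l e) (run (push arr len x) st).
Proof.
move=> /negPf al small ce hx hx' ls v.
have := small v; have := small (h e).
rewrite !filter_rcons eqxx size_rcons => small1 small2.
have -> : run (push arr len x) st = State
   (upd (upd (nmem st) arr (vertex_code (h e) + vertex_code (h e) + size [seq e' <- l | h e' == h e])
             (arc_code e)) len (vertex_code (h e)) (size [seq e' <- l | h e' == h e]).+1) (rmem st).
  rewrite /push run_seq !run_nset ce.
  rewrite -[neval st (NAdd _ _)]/(neval st x + neval st x + nmem st len (neval st x)) hx.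
  rewrite (proj1 (ls (h e))) hx'; congr (State (upd _ _ _ _) _).
  rewrite -[neval _ _]/(upd (nmem st) arr _ _ len (neval _ x) + 1) hx' /upd eq_sym al /=.
  by rewrite (proj1 (ls (h e))) addn1.
have [lv lq] := ls v.
rewrite /= /upd eqxx al eqxx /= [len == arr]eq_sym al /= (inj_eq (@vertex_code_inj G)).
split.
  by rewrite [h e == v]eq_sym; case: eqVneq => [->|_]; rewrite ?size_rcons.
move=> q; move: small2; case: eqVneq => [<-|ne]; last first.
  move=> s2 hq; rewrite lq //; case: eqP => // E; case/negP: ne.
  apply/eqP/vertex_code_inj; move: small1; lia.
rewrite map_rcons nth_rcons size_map size_rcons eqn_add2l => s2.
rewrite ltnS leq_eqVlt; case: eqP => [->|_] /=; first by rewrite ltnn ?eqxx.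
by move=> hq; rewrite hq; apply: (proj2 (ls (h e))).
Qed.

Lemma size_fiber (h : arc G -> vertex G) l v : uniq l ->
  size [seq e <- l | h e == v] <= #|[set e | h e == v]|.
Proof.
move=> ul; rewrite cardE; apply: uniq_leq_size; first exact: filter_uniq.
by move=> e; rewrite mem_filter mem_enum inE => /andP[].
Qed.

Lemma indegree_le2 v : #|inarcs G v| <= 2.
Proof.
case: v => [[i|s]|o]; first by rewrite (proj2 (input_deg i)).
  by rewrite (proj2 (splitter_deg s)).
by rewrite (proj2 (output_deg o)).
Qed.

Lemma outdegree_le2 v : #|outarcs G v| <= 2.
Proof.
case: v => [[i|s]|o]; first by rewrite (proj1 (input_deg i)).
  by rewrite (proj1 (splitter_deg s)).
by rewrite (proj1 (output_deg o)).
Qed.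

Lemma listed_pair arr len (h : arc G -> vertex G) v st :
  listed arr len h (enum (arc G)) st -> #|[set e | h e == v]| = 2 ->
  exists e f, [/\ [set e | h e == v] = [set e; f],
    nmem st arr (vertex_code v + vertex_code v) = arc_code e &
    nmem st arr (vertex_code v + vertex_code v + 1) = arc_code f].
Proof.
move=> /(_ v)[_ lq] card2.
have : size [seq e <- enum (arc G) | h e == v] = 2.
  rewrite -card2 -(card_uniqP (filter_uniq _ (enum_uniq _))).
  by apply: eq_card => e; rewrite mem_filter mem_enum andbT inE.
have : [seq e <- enum (arc G) | h e == v] =i [set e | h e == v].
  by move=> e; rewrite mem_filter mem_enum andbT inE.
case: [seq e <- enum (arc G) | h e == v] lq => [|e [|f [|]]] // lq mE _.
exists e, f; split.
- by apply/setP => g; rewrite -mE !inE.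
- by have := lq 0 isT; rewrite addn0.
- exact: (lq 1 isT).
Qed.

Definition prepare_cost := #|arc G| * (cost cap_body + 2) + 2 +
  (#|arc G| * (cost flow_body + 2) + 2 + (#|arc G| * (cost adj_body + 2) + 2)).

Lemma invariant_started st : started (enum (arc G)) st -> invariant c (T st) (F st).
Proof.
move=> [_ _ sf sF].
have {}sf e : T st e = if direct e then cap c e else 0%R by rewrite sf mem_enum.
have {}sF e : (e \in F st) = direct_fluid e by rewrite sF mem_enum.
split.
- move=> e; rewrite sf; case: ifP => _; rewrite lexx ?andbT cap_ge0 //.
- move=> e ho; rewrite sF /direct_fluid negb_or negbK -ltNge sf => /andP[-> /ltW h].
  exact/min_idPr.
- move=> e ti ho; rewrite sF /direct_fluid sf /direct ti ho /= => h; exact/min_idPl.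
- move=> s; rewrite !big1 // => e; rewrite inE => /eqP he; rewrite sf /direct he //=.
  by rewrite andbF.
- move=> e f ef; rewrite sF /direct_fluid negb_or negbK => /andP[/andP[_ ho] _].
  by rewrite (output_head_inj ho ef).
- move=> e f ef _; have [/andP[ti _]|nd] := boolP (direct f).
    by have <- : e = f by apply: input_tail_inj; rewrite ?ef.
  by rewrite !sf (negPf nd); case: ifP; rewrite ?cap_ge0.
- move=> e f ef; rewrite sF /direct_fluid negb_or negbK => /andP[/andP[_ ho] _] _.
  by move: ho; rewrite ef; case tf: (tail f) => [[i|s]|o] //; case: (tail_not_output tf).
Qed.

Lemma ok_prepare slv : ok slv prepare (init_state c) prepare_cost
  (fun st => [/\ env c st, @labels_zero R G st & invariant c (T st) (F st)]).
Proof.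
have labz st na ra : frame na ra (init_state c) st -> LABEL \notin na -> @labels_zero R G st.
  by move=> fr h v _; rewrite (proj1 fr).
apply: (ok_seq (@ok_for_all_arcs slv cap_body (init_state c)
   (fun l st => forall e, e \in l -> rmem st CAP (arc_code e) = cap c e)
   _ _ _ _ init_data init_capacity _ _)) => //.
  move=> l e st k el ul d cd fr ce h; exact: cap_body_spec.
move=> st1 [fr1 d1 cd1 cp1].
apply: (ok_seq (@ok_for_all_arcs slv flow_body st1 started _ _ _ _ d1 cd1 _ _)) => //.
- split=> //.
  + by rewrite -[LHS]/(nmem st1 LEN 0) (proj1 fr1).
  + by move=> e; rewrite -[LHS]/(rmem st1 1 (arc_code e)) (proj2 fr1).
  + move=> e; rewrite inE -[nmem _ _ _]/(nmem st1 3 (arc_code e)) (proj1 fr1) //.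
- move=> l e st k el ul d cd fr ce; apply: flow_body_spec => // f.
  by rewrite (proj2 fr) // cp1 // mem_enum.
move=> st2 [fr2 d2 cd2 sd2].
have z2 a j : a \notin CNT :: nmods flow_body -> a \notin CNT :: nmods cap_body ->
    2 < a -> nmem st2 a j = 0.
  by move=> h2 h1; rewrite (proj1 fr2) // (proj1 fr1) //; case: a {h1 h2} => [|[|[|]]].
pose Inv3 l st := listed INS INCNT (fun e => head e) l st /\
                  listed OUTS OUTCNT (fun e => tail e) l st.
apply: ok_weaken (leqnn _) _ (@ok_for_all_arcs slv adj_body st2 Inv3 _ _ _ _ d2 cd2 _ _) => //.
- move=> st3 [fr3 d3 cd3 [l1 l2]].
  have T3 : T st3 = T st2 by rewrite (T_frame G fr3).
  have F3 : F st3 = F st2 by rewrite (F_frame G fr3).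
  split; last by rewrite T3 F3; apply: invariant_started.
    split=> //.
    + split=> s.
        exact: (listed_pair l1 (proj2 (splitter_deg s))).
      exact: (listed_pair l2 (proj1 (splitter_deg s))).
    + by rewrite (proj1 fr3) // (std_len sd2).
    + by move=> k hk; rewrite (proj1 fr3) // (std_list sd2).
    + by move=> e; rewrite (proj2 fr3) // (proj2 fr2) // cp1 // mem_enum.
  by move=> v _; rewrite (proj1 fr3) // z2.
- by split=> v; split=> //=; rewrite -[LHS]/(nmem st2 _ _) z2.
move=> l e st k el ul d cd fr ce [l1 l2].
have ur : uniq (rcons l e) by rewrite rcons_uniq el.
rewrite /adj_body run_seq.
have ct := neval_tail d ce; have ch := neval_head d ce.
have l1' : listed INS INCNT (fun e => head e) (rcons l e) (run (push INS INCNT (head_of cnt)) st).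
  apply: listed_push => // v; apply: leq_trans (size_fiber _ _ ur) (indegree_le2 v).
split; first exact: l1'.
apply: (@listed_push OUTS OUTCNT (fun e => tail e)) => // v.
exact: leq_trans (size_fiber _ _ ur) (outdegree_le2 v).
Qed.

End Prepare.

Section Main.
Variables (R : realType) (G : splitter_network) (c : input G + output G -> R).
Hypothesis c01 : forall x, (0 <= c x <= 1)%R.
Implicit Types (st : state R) (e f : arc G) (v : vertex G) (s : splitter G).
Local Notation T := (@out_throughput R G).
Local Notation F := (@out_fluid R G).

Lemma size_arcs : size (arcs G) <= 4 * #|splitter G|.
Proof.
have -> : size (arcs G) = \sum_(e : arc G) ~~ direct e.
  rewrite size_filter -sum1_count big_mkcond /= enumT.
  by apply: eq_bigr => e _; case: (direct e).
have le1 e : ~~ direct e <= \sum_s ((head e == vspl s) + (tail e == vspl s)).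
  rewrite /direct; case te: (tail e) => [[i|s]|o].
  - case he: (head e) => [[i'|s]|o] //=; first by case: (head_not_input he).
    by rewrite (bigD1 s) //= eqxx.
  - by rewrite (bigD1 s) //= eqxx addn1.
  - by case: (tail_not_output te).
apply: (@leq_trans (\sum_e \sum_s ((head e == vspl s) + (tail e == vspl s)))).
  by apply: leq_sum => e _; apply: le1.
rewrite exchange_big /= mulnC -sum_nat_const; apply: leq_sum => s _.
have sumE (h : arc G -> bool) : \sum_e h e = #|[set e | h e]|.
  rewrite -sum1_card [RHS]big_mkcond /=; apply: eq_bigr => e _.
  by rewrite inE; case: (h e).
rewrite big_split /= !sumE -/(inarcs G (vspl s)) -/(outarcs G (vspl s)).
by rewrite (proj1 (splitter_deg s)) (proj2 (splitter_deg s)).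
Qed.

Lemma card_arcs : #|arc G| = size (arcs G) + #|direct_arcs G|.
Proof.
rewrite -(cardC (mem (direct_arcs G))) addnC; congr addn.
rewrite -(card_uniqP (arcs_uniq G)); apply: eq_card => e.
by rewrite !inE mem_arcs.
Qed.

Definition check_cost := 1 + (size (arcs G) * (cost open_body + 2) + 2).
Definition round_cost (slv : solver R) := pass_cost G + (step_cost G slv).+1 + check_cost.

Record loop_inv (n : nat) st : Prop := LoopInv {
  li_env : env c st;
  li_zero : @labels_zero R G st;
  li_inv : invariant c (T st) (F st);
  li_open : nmem st OPEN 0 = has (open_input c st) (arcs G);
  (* [phi] grows in every round, except that a step may only make two arcs into a
     splitter equal; then the next pass saturates an arc. *)
  li_fuel : 8 * size (arcs G) <= n + 2 * phi c (T st) (F st) \/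
    8 * size (arcs G) <= n + (2 * phi c (T st) (F st)).+1 /\ ~ normalized c (T st) (F st)
}.

Lemma ok_check_inv slv n st : env c st -> @labels_zero R G st -> invariant c (T st) (F st) ->
  (8 * size (arcs G) <= n + 2 * phi c (T st) (F st) \/
   8 * size (arcs G) <= n + (2 * phi c (T st) (F st)).+1 /\ ~ normalized c (T st) (F st)) ->
  ok slv check st check_cost (loop_inv n).
Proof.
move=> E lz I fuel.
apply: ok_weaken (leqnn _) _ (ok_check slv E) => st' [fr h].
have T' : T st' = T st by rewrite (T_frame G fr).
have F' : F st' = F st by rewrite (F_frame G fr).
split; rewrite ?T' ?F' //.
- exact: env_frame fr _ _ E.
- by move=> v nv; rewrite (proj1 fr) // lz.
- by rewrite h /open_input T' F'.
Qed.

Lemma ok_round slv n st : loop_inv n st -> beval st (NLe (NConst 1) (nvar OPEN)) ->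
  exists2 n', n = n'.+1 & ok slv round st (round_cost slv) (loop_inv n').
Proof.
move=> [E lz I op fuel] /=; rewrite op lt0b => hop.
have M0 : 0 < size (arcs G) by case: (arcs G) hop.
have phi3 := phi_bound c (T st) (F st).
case: n fuel => [|n] fuel; first by exfalso; case: fuel => [|[+ _]]; lia.
exists n => //.
apply: (ok_seq (Q1 := fun st' => [/\ env c st', @labels_zero R G st',
    invariant c (T st') (F st') &
    8 * size (arcs G) <= n + 2 * phi c (T st') (F st') \/
    8 * size (arcs G) <= n + (2 * phi c (T st') (F st')).+1 /\
      ~ normalized c (T st') (F st')])); last first.
  by move=> st' [E' lz' I' fuel']; apply: ok_check_inv.
apply: (ok_seq (ok_pass slv c01 E I)) => st1 [fr1 [I1 h1]].
have E1 : env c st1 by apply: env_frame fr1 _ _ E.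
have T1 : T st1 = T st by rewrite (T_frame G fr1).
have lz1 : @labels_zero R G st1 by move=> v nv; rewrite (proj1 fr1) // lz.
apply: ok_if; rewrite /=; case: ifP => ch.
  apply: (ok_weaken (k := 1) _ (Q := eq st1)); [| |exact: (@ok_run R slv Skip st1 (eq st1))]; last first.
    move=> _ <-; split=> //; rewrite ?T1 //; left; move: h1; case: (nmem st1 CHANGED 0) ch => // m _.
    by case: fuel => [|[+ _]]; lia.
  by rewrite /step_cost /build_cost; lia.
move: h1; case: (nmem st1 CHANGED 0) ch => // _ [F1 N].
rewrite F1 -T1 in I1; rewrite -T1 -F1 in N fuel I1.
have ex : exists2 e, e \in arcs G & open_input c st1 e.
  by case/hasP: hop => e eI oe; exists e => //; rewrite /open_input T1 F1.
apply: ok_weaken (leqnn _) _ (ok_step c01 slv E1 lz1 I1 N ex) => st2 [fr2 lz2 I2 pr].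
split=> //; first exact: env_frame fr2 _ _ E1.
case: fuel => [fuel|[_ //]]; case: pr => [|[? nn]]; [left; lia|right; split=> //; lia].
Qed.

Lemma ok_main slv : ok slv main (init_state c)
  (prepare_cost G + (check_cost + (8 * size (arcs G) * (round_cost slv).+1 + 1)))
  (fun st => steady_state c (T st) (F st)).
Proof.
apply: (ok_seq (ok_prepare c01 slv)) => st0 [E0 lz0 I0].
apply: (ok_seq (Q1 := loop_inv (8 * size (arcs G)))).
  by apply: ok_check_inv => //; left; rewrite leq_addr.
move=> st1 inv1.
apply: ok_weaken (leqnn _) _ (ok_while (B := round_cost slv) (fun n st => @ok_round slv n st) inv1).
move=> st [[n [E lz I op _]]] /=; rewrite op lt0b => /hasPn no.
apply: (invariant_steady c01 I) => e ti eF ho.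
have := no e; rewrite mem_arcs /direct (negPf ho) andbF => /(_ isT).
by rewrite /open_input eF ti -leNgt.
Qed.

Lemma main_cost slv :
  prepare_cost G + (check_cost + (8 * size (arcs G) * (round_cost slv).+1 + 1)) <=
  100 * 200 * (#|splitter G| ^ 2 + #|splitter G| * sd slv (merged G) + #|direct_arcs G| + 1).
Proof.
rewrite /prepare_cost card_arcs /round_cost /pass_cost /step_cost /build_cost /check_cost /=.
have := size_arcs; set M := size _; set a := #|splitter G|; set d := #|_|; set x := sd _ _ => Ma.
set B := (X in 8 * M * X); have hB : B <= 300 * a + x + 60 by rewrite /B; lia.
have MB : M * B <= 4 * a * (300 * a + x + 60) by apply: leq_mul.
have aa : a <= a * a by case: (a) => // n; rewrite leq_pmulr.
rewrite mulnDr mulnDr in MB; rewrite -mulnA expnS expn1; lia.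
Qed.

End Main.

Local Open Scope ring_scope.

Theorem theorem1 (R : realType) :
  exists (P : cmd) (C : nat),
  forall (slv : solver R) (G : splitter_network) (c : input G + output G -> R),
  (forall x, 0 <= c x <= 1) ->
  exists (st : state R) (k : nat),
    [/\ exec slv P (init_state c) st k,
        steady_state c (out_throughput st) (out_fluid G st)
      & (k <= C * (#|splitter G| ^ 2 + #|splitter G| * sd slv (merged G)
                   + #|direct_arcs G| + 1))%N].
Proof.
exists main, (100 * 200)%N => slv G c c01.
have [st [k [ex kc ss]]] := ok_main c01 slv.
by exists st, k; split=> //; apply: leq_trans kc (main_cost _ slv).
Qed.
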